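(* Let $G$ be a cocompactly cubulated group. (1) For every finitely generated subgroup $H\leq G$, the centraliser $Z_G(H)$ is cocompactly cubulated. (2) If $G=G_1\times G_2$ and $G_2$ has finite centre, then $G_1$ is cocompactly cubulated.
   Context: A group $G$ is cocompactly cubulated if it admits a proper cocompact action by cubical automorphisms on a CAT(0) cube complex. *)

(* Defs.v *)
From HB Require Import structures.
From Stdlib Require Import Relation_Operators.
From mathcomp Require Import all_boot.
From mathcomp Require Import boolp classical_sets functions cardinality.

Set Implicit Arguments.
Unset Strict Implicit.
Unset Printing Implicit Defensive.

Local Open Scope classical_set_scope.
Local Open Scope group_scope.

(* Groups are the (possibly infinite) [groupType]s of monoid.v.  Their
   [choiceType] structure is no restriction in the presence of the axioms of
   boolp. *)

Section Groups.
Variable G : groupType.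

Definition subgroup (H : set G) : Prop :=
  [/\ H 1, (forall x y, H x -> H y -> H (x * y)) & (forall x, H x -> H x^-1)].

Definition finitely_generated (H : set G) : Prop :=
  exists2 S : set G, finite_set S & H = smallest subgroup S.

Definition centraliser (H : set G) : {pred G} :=
  fun g => `[< forall h, H h -> commute g h >].

Lemma centraliser_closed (H : set G) : group_closed (centraliser H).
Proof.
split=> [|x y /asboolP Hx /asboolP Hy]; apply/asboolP => h Hh.
  exact/commute_sym/commute1.
apply/commute_sym/commuteM; first exact/commute_sym/Hx.
exact/commuteV/commute_sym/Hy.
Qed.

Record centraliser_group (H : set G) := CentraliserGroup {
  centraliser_val : G;
  _ : centraliser_val \in centraliser H
}.

HB.instance Definition _ (H : set G) :=
  [isSub of centraliser_group H for @centraliser_val H].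
HB.instance Definition _ (H : set G) := [Choice of centraliser_group H by <:].
HB.instance Definition _ (H : set G) :=
  SubChoice_isSubGroup.Build G (centraliser H) (centraliser_group H)
    (centraliser_closed H).

End Groups.

Definition centre (G : groupType) : set G := [set z | forall g, commute z g].
Arguments centre : clear implicits.

(* The face of the cube {0,1}^n obtained by prescribing the coordinates [i]
   such that [s i = Some b]. *)
Definition cube_face n (s : {ffun 'I_n -> option bool}) :
    set {ffun 'I_n -> bool} :=
  [set x | forall i b, s i = Some b -> x i = b].

(* Cubical complexes in the sense of Bridson-Haefliger (I.7.32): every cube is
   embedded, and two cubes are either disjoint or meet in a common face.  Such a
   complex is determined by the vertex sets of its (closed) cubes.  In
   [cubeP], [f] is the restriction to {0,1}^n of a characteristic map
   [0,1]^n -> X: the cubes contained in a given cube are exactly its faces.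
   There is no loss of generality for the complexes considered here: in a CAT(0)
   cube complex, cubes are embedded and intersect in common faces. *)
Record cube_complex := CubeComplex {
  vertex :> Type;
  cube : set (set vertex);
  cube1 : forall v, cube [set v];
  cubeP : forall c, cube c ->
    exists n, exists f : {ffun 'I_n -> bool} -> vertex,
      [/\ injective f, range f = c &
        forall a, a `<=` c -> (cube a <-> exists s, a = f @` cube_face s)];
  cubeI : forall c d, cube c -> cube d -> c `&` d !=set0 -> cube (c `&` d)
}.

Section CAT0.
Variable X : cube_complex.

Definition adjacent : rel X := fun u v => `[< u <> v /\ cube [set u; v] >].

(* u, v, w, t are the vertices of a square, in cyclic order. *)
Definition square_boundary (u v w t : X) : Prop :=
  [/\ cube ([set u; v] `|` [set w; t]), u <> w, v <> t &
      cycle adjacent [:: u; v; w; t]].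

(* A path in the 1-skeleton is encoded by the sequence of its vertices. *)
Inductive elementary_homotopy : seq X -> seq X -> Prop :=
| homotopy_backtrack p q u v : adjacent u v ->
    elementary_homotopy (p ++ [:: u; v; u] ++ q) (p ++ u :: q)
| homotopy_square p q u v w t : square_boundary u v w t ->
    elementary_homotopy (p ++ [:: u; v; w; t; u] ++ q) (p ++ u :: q).

Definition homotopic : seq X -> seq X -> Prop :=
  clos_refl_sym_trans (seq X) elementary_homotopy.

Definition connected_complex : Prop :=
  (exists v : X, True) /\
  forall u v : X, exists2 p, path adjacent u p & last u p = v.

(* The fundamental group is taken to be the edge-path group of the 2-skeleton. *)
Definition simply_connected : Prop :=
  connected_complex /\
  forall (v : X) (p : seq X), path adjacent v p -> last v p = v ->
    homotopic (v :: p) [:: v].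

(* The simplices of the link of [v], a simplicial complex whose vertices are the
   edges issuing from [v]; such an edge is represented by its other endpoint.
   The cube {v} yields the empty simplex. *)
Definition link (v : X) : set (set X) :=
  [set E | exists2 c, cube c & c v /\ E = [set u | c u /\ adjacent v u]].

(* Taking u = u' forces the elements of E to be vertices of K. *)
Definition flag T (K : set (set T)) : Prop :=
  forall E : set T, finite_set E ->
    (forall u u', E u -> E u' -> K [set u; u']) -> K E.

Definition nonpositively_curved : Prop := forall v : X, flag (link v).

(* A cube complex is CAT(0) if it is simply connected and its vertex links are
   flag complexes. *)
Definition CAT0 : Prop := simply_connected /\ nonpositively_curved.

Definition cubical_automorphism (f : X -> X) : Prop :=
  bijective f /\ forall c, cube c <-> cube (f @` c).

Section Actions.
Variable G : groupType.

Definition cubical_action (a : G -> X -> X) : Prop :=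
  [/\ forall x, a 1 x = x, forall g h x, a (g * h) x = a g (a h x) &
      forall g, cubical_automorphism (a g)].

(* Compact subsets of the CW-complex X are contained in finite unions of closed
   cubes, which are compact; so in both definitions below the compact set ranges over the unions |K| of finite
   sets K of closed cubes.  Two closed cubes meet iff they share a vertex; a
   point in the interior of a cube c lies in a closed cube k iff c is a face of
   k. *)

(* {g | g|K| meets |K|} is finite, for every compact |K|. *)
Definition proper_action (a : G -> X -> X) : Prop :=
  forall K : set (set X), finite_set K -> K `<=` @cube X ->
    finite_set [set g : G | exists c d,
      [/\ K c, K d & (a g @` c) `&` d !=set0]].

(* X is the union of the translates of some compact |K|. *)
Definition cocompact_action (a : G -> X -> X) : Prop :=
  exists K : set (set X), [/\ finite_set K, K `<=` @cube X &
    forall c, cube c -> exists g, exists2 k, K k & c `<=` a g @` k].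

End Actions.
End CAT0.

Definition cocompactly_cubulated (G : groupType) : Prop :=
  exists X : cube_complex, CAT0 X /\
    exists a : G -> X -> X,
      [/\ cubical_action a, proper_action a & cocompact_action a].

(* Main.v *)
Require Import Defs.
From Stdlib Require Import Relation_Operators.
From mathcomp Require Import all_boot finmap zify.
From mathcomp Require Import boolp classical_sets functions cardinality.

(* The vertex set of a CAT(0) cube complex is a discrete median algebra.  Indeed,
   edge paths without backtracks, up to flips across squares, are the vertices of
   the universal cover; simple connectivity makes them unique, the flag condition
   then yields the quadrangle condition, and hence medians and halfspaces.
   Conversely, a discrete median algebra is the vertex set of a CAT(0) cube
   complex.

   Let Z be the centraliser of a finite set S in a group G acting geometrically
   on such a median algebra.  As g^-1 s g takes finitely many values when gx is
   moved a bounded distance by s, the group Z acts cofinitely on the set Y_C of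
   vertices moved at most C by every s in S.  Let M be the median subalgebra
   generated by Y_C.  A chain of halfspaces between x in M and sx also lies
   between y and sy for some y in Y_C, so it has at most C members; hence M is
   contained in some Y_C', and Z acts cofinitely on M.  Normal cube paths fellow
   travel, so M is coarsely connected when C is large, which bounds the distance
   between neighbours in M.  Thus Z acts geometrically on the cube complex of M.

   For the second part, the centraliser of G_2 in G_1 x G_2 is the product of G_1
   and the centre of G_2, and cocompact cubulations restrict to subgroups of
   finite index. *)

Set Implicit Arguments.
Unset Strict Implicit.
Unset Printing Implicit Defensive.

Local Open Scope classical_set_scope.

(** * Cardinality of finite sets *)

(** The obstacle is local finiteness. One trace on [M] may come from many halfspaces of V, so
    neighbours in [M] may be far apart in V, and the degree of V does not control that of [M]. If x
    and y are neighbours in [M], then w -> [med x y w] is a 1-Lipschitz map from [M] to {x, y}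
    fixing x and y. A chain of points of [M] with jumps shorter than the distance of x and y could
    never pass from one to the other. Coarse connectivity of [M] is wanted for this bound.

    The constants come from one principle: a bound D on the degree bounds antichains of halfspaces
    by D, so a family of halfspaces between two vertices whose chains have at most C members has at
    most C * D elements.

    In passing from cube complexes to medians, the flag condition serves to complete three squares
    at a vertex to a 3-cube, which makes flip equivalence of reduced paths transitive.

    In the second part, the first part must be applied to the factor G_2. It is finitely generated
    as a quotient of G, which is finitely generated because it acts geometrically. *)

Section Card.
Context {T : Type}.
Implicit Types A B : set T.

(* 0 for infinite sets *)
Definition nb A : nat := #|` fset_set (A : set {classic T})|.

Lemma nb_sub A B : finite_set B -> A `<=` B -> nb A <= nb B.
Proof.
move=> fB sAB; have fA := sub_finite_set sAB fB.
by apply: fsubset_leq_card; rewrite -fset_set_sub.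
Qed.

Lemma nb_setU A B : finite_set A -> finite_set B -> nb (A `|` B) <= nb A + nb B.
Proof. by move=> fA fB; rewrite /nb fset_setU // cardfsU leq_subr. Qed.

Lemma nb_setU1 A x : finite_set A -> ~ A x -> nb (x |` A) = (nb A).+1.
Proof.
move=> fA Ax; rewrite /nb fset_setU1 // cardfsU1 in_fset_set //.
by rewrite memNset.
Qed.

Lemma nb_set1 x : nb [set x] = 1.
Proof. by rewrite /nb fset_set1 cardfs1. Qed.

Lemma nb0 : nb set0 = 0.
Proof. by rewrite /nb fset_set0. Qed.

Lemma nb_eq0 A : finite_set A -> nb A = 0 -> A = set0.
Proof. by move=> fA /eqP; rewrite cardfs_eq0 => /eqP; apply: fset_set_set0. Qed.

Lemma nb_proper A B x : finite_set B -> A `<=` B -> B x -> ~ A x -> nb A < nb B.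
Proof.
move=> fB sAB Bx Ax; have fA := sub_finite_set sAB fB.
rewrite -(nb_setU1 fA Ax); apply: nb_sub => // y [->//|]; exact: sAB.
Qed.

Lemma nb_sub_eq A B : finite_set B -> A `<=` B -> nb B <= nb A -> A = B.
Proof.
move=> fB sAB le; apply/seteqP; split=> // x Bx; apply: contrapT => Ax.
by have := nb_proper fB sAB Bx Ax; rewrite ltnNge le.
Qed.

Lemma nb_eq1 A : finite_set A -> nb A = 1 -> exists x, A = [set x].
Proof.
move=> fA nA; case: (pselect (A !=set0)) => [[x Ax]|/set0P/negP/negPn/eqP A0]; last first.
  by move: nA; rewrite A0 nb0.
exists x; apply/esym/nb_sub_eq => //; first by move=> y ->.
by rewrite nA nb_set1.
Qed.

End Card.

Lemma nb_image_le T U (f : T -> U) (A : set T) : finite_set A -> nb (f @` A) <= nb A.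
Proof.
move=> fA; rewrite /nb (@fset_set_image {classic T} {classic U}) //; exact: leq_imfset_card.
Qed.

Lemma nb_image T U (f : T -> U) (A : set T) : finite_set A ->
  (forall x y, A x -> A y -> f x = f y -> x = y) -> nb (f @` A) = nb A.
Proof.
move=> fA inj; rewrite /nb (@fset_set_image {classic T} {classic U}) //.
apply: card_in_imfset => /= x y; rewrite !in_fset_set // !inE; exact: inj.
Qed.

Lemma nb_le_inj T U (f : T -> U) (A : set T) (B : set U) : finite_set A -> finite_set B ->
  (forall x, A x -> B (f x)) ->
  (forall x y, A x -> A y -> f x = f y -> x = y) -> nb A <= nb B.
Proof.
move=> fA fB AB inj; rewrite -(nb_image fA inj); apply: nb_sub => // y [x Ax <-]; exact: AB.
Qed.

Lemma finite_powerset T (A : set T) : finite_set A -> finite_set [set B | B `<=` A].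
Proof.
move=> fA.
apply: (@sub_finite_set _ _ ((fun X : {fset {classic T}} => [set` X] : set T) @`
  [set` fpowerset (fset_set (A : set {classic T}))])); last first.
  exact/finite_image/finite_fset.
move=> B /= BA; have fB := sub_finite_set BA fA.
exists (fset_set (B : set {classic T})); last by rewrite fset_setK.
by rewrite /= fpowersetE -fset_set_sub.
Qed.

(** * Discrete median algebras *)

Definition sep V (W : set (set V)) (x y : V) : set (set V) :=
  [set h | [/\ W h, ~ h x & h y]].

(* A discrete median algebra presented by its halfspaces. *)
Record median_walls V (W : set (set V)) : Prop := MedianWalls {
  wallC : forall h, W h -> W (~` h);
  finite_sep : forall x y, finite_set (sep W x y);
  sep_eq0 : forall x y, sep W x y = set0 -> x = y;
  wall_median : forall x y z, exists m, forall h, W h ->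
    (h x /\ h y) \/ (h y /\ h z) \/ (h x /\ h z) -> h m
}.

Section Walls.
Variables (V : Type) (W : set (set V)).
Hypothesis mw : median_walls W.
Local Notation sep := (sep W).
Let finite_sep := finite_sep mw.
Let wallC := wallC mw.

Definition med x y z : V := projT1 (cid (wall_median mw x y z)).

(** [wall_median] gives one implication. Applied to the complement of [h] it gives the other,
    because a majority outside [h] is the negation of a majority inside. *)
Lemma med_iff h x y z : W h ->
  h (med x y z) <-> (h x /\ h y) \/ (h y /\ h z) \/ (h x /\ h z).
Proof.
rewrite /med; case: cid => m /= mP Wh; split; last exact: mP.
have := mP _ (wallC Wh); rewrite /setC /=; move: (EM (h x)) (EM (h y)) (EM (h z)) (EM (h m)). tauto.
Qed.

Lemma eq_walls x y : (forall h, W h -> h y -> h x) -> x = y.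
Proof.
move=> xy; apply: (sep_eq0 mw); apply/seteqP; split=> // h [Wh hx hy].
by apply: hx; apply: xy.
Qed.

Lemma sepxx x : sep x x = set0.
Proof. by apply/seteqP; split=> // h []. Qed.

Lemma sep_setC x y h : sep x y h -> sep y x (~` h).
Proof. by case=> Wh hx hy; split; [exact: wallC|rewrite /setC /=; tauto|]. Qed.

Lemma nb_sepC x y : nb (sep x y) = nb (sep y x).
Proof.
have le a b : nb (sep a b) <= nb (sep b a).
  apply: (nb_le_inj (f := setC)) => // [h|h k _ _ hk]; first exact: sep_setC.
  by rewrite -(setCK h) hk setCK.
by apply/eqP; rewrite eqn_leq !le.
Qed.

Lemma sep_triangle y x z : sep x z `<=` sep x y `|` sep y z.
Proof. by move=> h [Wh hx hz]; case: (pselect (h y)) => hy; [left|right]. Qed.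

Lemma nb_sep_triangle y x z : nb (sep x z) <= nb (sep x y) + nb (sep y z).
Proof.
apply: leq_trans (nb_setU _ _) => //; apply: nb_sub; last exact: sep_triangle.
by rewrite finite_setU.
Qed.

Lemma nb_sep_eq0 x y : nb (sep x y) = 0 -> x = y.
Proof. by move/(nb_eq0 (finite_sep _ _))/(sep_eq0 mw). Qed.

(** Choose [y] in [k] with [sep u y] inside [sep u v] and as small as possible. By maximality,
    another [h] in [sep u y] does not contain [k]; for [z] in [k] outside [h], the vertex
    [med u y z] is still in [k] but no longer in [h]. *)
Lemma sep_maximal_adjacent u v k : sep u v k ->
  (forall h, sep u v h -> k `<=` h -> h = k) -> exists y, sep u y = [set k].
Proof.
move=> uvk maxk.
suff /(_ (nb (sep u v)) v) : forall n y, nb (sep u y) <= n -> k y ->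
    sep u y `<=` sep u v -> exists y, sep u y = [set k].
  by apply=> //; case: uvk.
elim=> [|n IH] y ny ky uy.
  have : sep u y = set0 by apply: nb_eq0 => //; lia.
  by move/seteqP => [/(_ k)]; case: uvk => ? ? _ H _; case: H.
case: (pselect (sep u y `<=` [set k])) => [yk|/existsNP[h /not_implyP[uyh /= hk]]].
  by exists y; apply/seteqP; split=> // _ ->; case: uvk => ? ? _; split.
have [z /not_implyP[kz hz]] : exists z, ~ (k z -> h z).
  by apply/existsNP => kh; apply/hk/maxk => //; exact: uy.
have Wk : W k by case: uvk.
have Wh : W h by case: uyh.
apply: (IH (med u y z)).
- rewrite -ltnS; apply: leq_trans ny; apply: (nb_proper (x := h)) => //.
  + move=> l [Wl lu /(med_iff _ _ _ Wl) lm]; split=> //.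
    by move: lm (EM (l y)); tauto.
  + case: uyh => _ hu hy [_ _ /(med_iff _ _ _ Wh)]; tauto.
- by apply/med_iff => //; tauto.
- apply: subset_trans uy => l [Wl lu /(med_iff _ _ _ Wl) lm]; split=> //; tauto.
Qed.

Lemma exists_maximal (A : set (set V)) k : finite_set A -> A k ->
  exists2 m, A m & k `<=` m /\ forall h, A h -> m `<=` h -> h = m.
Proof.
move=> fA.
suff : forall n k, A k -> nb [set h | A h /\ k `<=` h] <= n ->
    exists2 m, A m & k `<=` m /\ forall h, A h -> m `<=` h -> h = m.
  by move=> H Ak; apply: (H _ _ Ak (leqnn _)).
elim=> [|n IH] {}k Ak nk.
  suff : [set h | A h /\ k `<=` h] = set0.
    by move/seteqP => [H _]; case: (H k); split.
  by apply: nb_eq0; [apply: sub_finite_set fA => ? []|lia].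
case: (pselect (exists h, [/\ A h, k `<=` h & h <> k])) => [[h [Ah kh hk]]|nh].
  have [|m Am [hm mmax]] := IH h Ah.
    rewrite -ltnS; apply: leq_trans nk; apply: (nb_proper (x := k)) => //=.
    - by apply: sub_finite_set fA => ? [].
    - by move=> l [Al hl]; split=> //; exact: subset_trans hl.
    - by split.
    - by case=> _ hk'; apply: hk; apply/seteqP.
  by exists m => //; split=> //; exact: subset_trans hm.
exists k => //; split=> // h Ah kh; apply: contrapT => hk; apply: nh.
by exists h.
Qed.

Lemma sep_shift u v u1 k : sep u v k -> sep u u1 = [set k] ->
  sep u1 v = sep u v `\ k.
Proof.
move=> [Wk ku kv] u1k; have [_ _ ku1] : sep u u1 k by rewrite u1k.
apply/seteqP; split=> [h [Wh hu1 hv]|h [[Wh hu hv] /= hk]].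
  split; last by move=> /= hk; apply: hu1; rewrite hk.
  split=> // hu; have : sep u u1 (~` h).
    by split=> //; exact: wallC.
  by rewrite u1k /= => hk; move: kv; rewrite -hk /setC /=.
split=> // hu1; apply: hk.
by have : sep u u1 h by []; rewrite u1k.
Qed.

(** A path from [u] to [v] cannot enter a halfspace before those containing it. The induction
    crosses a maximal member of [U], which is maximal in [sep u v] because [U] is an up-set, and
    restarts at the adjacent vertex. *)
Lemma realize_upset u v (U : set (set V)) : U `<=` sep u v ->
  (forall h k, U h -> sep u v k -> h `<=` k -> U k) ->
  exists p, sep u p = U.
Proof.
move: {2}(nb (sep u v)) (leqnn (nb (sep u v))) => n.
elim: n u v U => [|n IH] u v U nuv Uuv upU.
  exists u; rewrite sepxx; apply/esym/seteqP; split=> // h /Uuv.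
  suff -> : sep u v = set0 by [].
  by apply: nb_eq0 => //; lia.
case: (pselect (U !=set0)) => [[h Uh]|/set0P/negP/negPn/eqP ->]; last first.
  by exists u; rewrite sepxx.
have [k Uk [_ kmax]] := exists_maximal (sub_finite_set Uuv (finite_sep u v)) Uh.
have uvk := Uuv _ Uk.
have [u1 u1k] : exists u1, sep u u1 = [set k].
  apply: (sep_maximal_adjacent uvk) => l uvl kl; apply: kmax => //; exact: upU kl.
have shift := sep_shift uvk u1k.
have [p pE] : exists p, sep u1 p = U `\ k.
  apply: (IH u1 v).
  - rewrite shift -ltnS; apply: leq_trans nuv.
    by apply: (nb_proper (x := k)) => // -[_]; apply.
  - by rewrite shift => l [Ul lk]; split=> //; exact: Uuv.
  - move=> l m [Ul lk]; rewrite shift => -[uvm mk] lm; split=> //; exact: upU lm.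
exists p; have [Wk ku ku1] : sep u u1 k by rewrite u1k.
have kp : k p.
  apply: contrapT => kp.
  have [/Uuv [_ _ kv] _] : (U `\ k) (~` k) by rewrite -pE; split=> //; exact: wallC.
  by case: uvk.
apply/seteqP; split=> [l upl|l Ul].
  have [|] := sep_triangle u1 upl; first by rewrite u1k => ->.
  by rewrite pE => -[].
case: (pselect (l = k)) => [->//|lk].
have [Wl lu1 lp] : sep u1 p l by rewrite pE.
split=> //; by case: (Uuv _ Ul).
Qed.

(** Over [h] lies a strictly ascending chain of [n] further halfspaces of [sep u v], so a normal
    cube path, which crosses no two nested halfspaces in one step, cannot cross [h] during its first
    [n] steps. *)
Fixpoint level u v n (h : set V) : Prop :=
  if n is n'.+1 then
    exists h', [/\ sep u v h', h `<=` h', h <> h' & level u v n' h']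
  else True.

Lemma level_sub u v n h h' : sep u v h' -> h `<=` h' -> level u v n h' -> level u v n h.
Proof.
case: n => // n uvh' hh' [h'' [uvh'' h'h'' ne lev]]; exists h''; split=> //.
  exact: subset_trans h'h''.
by move=> e; apply: ne; apply/seteqP; split=> //; rewrite -e.
Qed.

Lemma levelS u v n h : level u v n.+1 h -> level u v n h.
Proof. by case=> h' [uvh' hh' _]; exact: level_sub. Qed.

(** [top] is the outermost of the [n + 1] members of the chain, counting [h], so the whole chain
    separates [a] from [b]. The conclusion no longer involves [u] and [v], which allows comparison
    with other pairs of points. *)
Lemma level_chain u v n h : sep u v h -> level u v n h ->
  exists top, [/\ sep u v top, h `<=` top & forall a b, ~ top a -> h b ->
    n < nb [set w | sep a b w /\ h `<=` w]].
Proof.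
elim: n h => [|n IH] h uvh.
  move=> _; exists h; split=> // a b ha hb.
  have -> : 0 < nb [set w | sep a b w /\ h `<=` w] = (nb [set h] <= nb [set w | sep a b w /\ h `<=` w]).
    by rewrite nb_set1.
  apply: nb_sub; first by apply: sub_finite_set (finite_sep a b) => ? [].
  by move=> _ ->; split=> //; split=> //; case: uvh.
move=> [h' [uvh' hh' ne /(IH _ uvh') [top [uvt h't topP]]]].
exists top; split=> //; first exact: subset_trans h't.
move=> a b ta hb; have := topP a b ta (hh' _ hb) => /leq_ltn_trans; apply.
apply: (nb_proper (x := h)).
- by apply: sub_finite_set (finite_sep a b) => ? [].
- by move=> w [abw h'w]; split=> //; exact: subset_trans h'w.
- split=> //; split=> //; [by case: uvh|by move=> /hh' /h't].
- by case=> _ h'h; apply: ne; apply/seteqP.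
Qed.

Lemma level_lt u v n h : sep u v h -> level u v n h -> n < nb (sep u v).
Proof.
move=> uvh /(level_chain uvh) [top [[_ tu _] _ /(_ u v tu)]].
case: uvh => Wh hu hv /(_ hv) /leq_trans; apply.
by apply: nb_sub => // w [].
Qed.

(* The n-th vertex of the normal cube path from [u] to [v]. *)
Definition normal_vertex u v n p :=
  sep u p = [set h | sep u v h /\ ~ level u v n h].

Lemma normal_vertex_exists u v n : exists p, normal_vertex u v n p.
Proof.
apply: (realize_upset (v := v)) => [h []//|h k [uvh lh] uvk hk]; split=> //.
by move=> lk; apply: lh; exact: level_sub lk.
Qed.

Lemma normal_vertex0 u v p : normal_vertex u v 0 p -> p = u.
Proof.
rewrite /normal_vertex => pE; apply/esym/(sep_eq0 mw); rewrite pE.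
by apply/seteqP; split=> // h [_]; apply.
Qed.

Lemma normal_vertex_last u v p : normal_vertex u v (nb (sep u v)) p -> p = v.
Proof.
rewrite /normal_vertex => pE.
have uE : sep u p = sep u v.
  rewrite pE; apply/seteqP; split=> [h []//|h uvh]; split=> // lh.
  by have := level_lt uvh lh; rewrite ltnn.
apply: eq_walls => h Wh hv; apply: contrapT => hp.
have hu : h u.
  by apply: contrapT => hu; apply: hp; have [] : sep u p h by rewrite uE.
have : sep u p (~` h) by split=> //; exact: wallC.
by rewrite uE => -[_ _].
Qed.

Definition neighbours x := [set y | nb (sep x y) = 1].

Section BoundedDegree.
Variable D : nat.
Hypothesis finite_neighbours : forall x, finite_set (neighbours x).
Hypothesis degree : forall x, nb (neighbours x) <= D.

(* An antichain of [sep u v] consists of the last halfspaces crossed on the way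
   to the vertex realising the up-set it generates. *)
Lemma nb_antichain u v (A : set (set V)) : A `<=` sep u v ->
  (forall h k, A h -> A k -> h `<=` k -> h = k) -> nb A <= D.
Proof.
move=> Auv antiA.
have [p pE] : exists p, sep u p = [set h | sep u v h /\ exists2 a, A a & a `<=` h].
  apply: (realize_upset (v := v)) => [h []//|h k [uvh [a Aa ah]] uvk hk].
  by split=> //; exists a => //; exact: subset_trans hk.
have [f fE] : {f & forall a, A a -> sep p (f a) = [set ~` a]}.
  apply: (choice (P := fun a y => A a -> sep p y = [set ~` a])) => a; case: (pselect (A a)) => [Aa|]; last by exists p.
  have upa : sep u p a by rewrite pE; split; [exact: Auv|exists a].
  have [|y yE] := sep_maximal_adjacent (sep_setC upa).
    move=> h /sep_setC; rewrite pE => -[_ [b Ab bh]] ah.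
    have ba : b = a.
      by apply: antiA => //; apply: subset_trans bh _ => z hz; apply: contrapT => /ah.
    apply/seteqP; split=> // z hz az; rewrite -ba in az; exact: bh hz.
  by exists y.
apply: leq_trans (degree p); apply: (nb_le_inj (f := f)) => //.
- exact: sub_finite_set (finite_sep u v).
- by move=> a Aa; rewrite /neighbours /= fE // nb_set1.
- move=> a b Aa Ab ab; apply: (can_inj (@setCK V)).
  have : sep p (f a) (~` a) by rewrite fE.
  by rewrite ab fE.
Qed.

(** Halfspaces of the same exact level form an antichain, since a proper inclusion raises the level;
    each of the [c] levels from [j] on contributes at most [D]. *)
Lemma nb_levels u v j c :
  nb [set h | [/\ sep u v h, level u v j h & ~ level u v (j + c) h]] <= c * D.
Proof.
have fin (P : set (set V)) : finite_set [set h | sep u v h /\ P h].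
  by apply: sub_finite_set (finite_sep u v) => h [].
elim: c => [|c IH].
  rewrite (_ : [set _ | _] = set0) ?nb0 //.
  by apply/seteqP; split=> // h []; rewrite addn0.
pose L := [set h | sep u v h /\ (level u v (j + c) h /\ ~ level u v (j + c).+1 h)].
have LD : nb L <= D.
  apply: (nb_antichain (u := u) (v := v)) => [h []//|h k [uvh [_ lh]] [uvk [lk _]] hk].
  by apply: contrapT => ne; apply: lh; exists k.
rewrite mulSn [D + _]addnC; apply: leq_trans (leq_add IH LD).
apply: leq_trans (nb_setU _ _); last exact: fin.
- apply: nb_sub => [|h [uvh lj]]; last first.
    rewrite addnS => lh; case: (pselect (level u v (j + c) h)) => l.
      by right; split.
    by left; split.
  rewrite finite_setU; split; last exact: fin.
  by apply: sub_finite_set (finite_sep u v) => h [].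
- by apply: sub_finite_set (finite_sep u v) => h [].
Qed.

(** In the chain over [h], the members containing [u] separate [u'] from [u], so there are at most
    [C] of them, all at the top. The lowest [k] members avoid [u], and they contain [v] because [h]
    does. *)
Lemma level_transfer C u v u' v' k h : nb (sep u' u) <= C ->
  sep u v h -> sep u' v' h -> level u' v' (C + k) h -> level u v k h.
Proof.
move=> uu'; elim: k h => // k IH h uvh uvh'; rewrite addnS => -[h' [h'E hh' ne lev]].
have [Wh' hu' hv'] := h'E.
have [hu|hu] := pselect (h' u).
  have [top [[_ tu' _] _ /(_ u' u tu' hu)]] := level_chain h'E lev.
  move=> lt; exfalso; suff : C + k < C by lia.
  apply: leq_trans lt (leq_trans _ uu'); apply: nb_sub => // w [] //.
have uvh'2 : sep u v h' by split=> //; apply: hh'; case: uvh.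
by exists h'; split=> //; exact: IH.
Qed.

(** At most [2 * C] halfspaces separate [u] from [u'] or [v] from [v']. Any other halfspace between
    [p] and [p'] is crossed in the same direction by both paths, by one of them within [n] steps and
    by the other later. By [level_transfer], its level on the faster path is at least [n - C] and
    less than [n], which leaves [C * D] halfspaces for either path. *)
Lemma normal_vertex_fellow C u v u' v' n p p' :
  nb (sep u u') <= C -> nb (sep v v') <= C ->
  normal_vertex u v n p -> normal_vertex u' v' n p' ->
  nb (sep p p') <= 2 * C + 2 * C * D.
Proof.
rewrite /normal_vertex => uu' vv' pE pE'.
pose B a b := [set h | [/\ sep a b h, level a b (n - C) h & ~ level a b n h]].
have fB a b : finite_set (B a b) by apply: sub_finite_set (finite_sep a b) => h [].
have BD a b : nb (B a b) <= C * D.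
  rewrite /B; have {2}-> : n = n - C + (n - (n - C)) by lia.
  apply: leq_trans (nb_levels _ _ _ _) _; rewrite leq_mul2r; lia.
have lem a b a' b' q q' h : nb (sep a' a) <= C ->
    sep a q = [set h | sep a b h /\ ~ level a b n h] ->
    sep a' q' = [set h | sep a' b' h /\ ~ level a' b' n h] ->
    sep a b h -> sep a' b' h -> ~ h q -> h q' -> B a' b' h.
  move=> aa' qE qE' abh abh' hq hq'.
  have [Wh ha' _] := abh'.
  have [_ nl] : sep a' b' h /\ ~ level a' b' n h.
    suff : sep a' q' h by rewrite qE'.
    by [].
  split=> //.
  have l : level a b n h.
    apply: contrapT => l; suff [] : sep a q h by [].
    by rewrite qE; split.
  have [nC|nC] := leqP n C; first by have -> : n - C = 0 by lia.
  apply: (level_transfer (C := C) (u' := a) (v' := b)) => //.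
    by rewrite nb_sepC.
  by have -> : C + (n - C) = n by lia.
apply: (@leq_trans (nb ((sep u u' `|` sep v v') `|` (B u' v' `|` setC @` B u v)))).
  apply: nb_sub.
    by rewrite !finite_setU; do !split=> //; exact: finite_image.
  move=> h [Wh hp hp'].
  have hC z : (~` h) z <-> ~ h z by [].
  (* If [u] is in [h], the halfspace being entered is the complement of [h], and the two paths
     exchange roles. *)
  have [hu|hu] := pselect (h u).
    have hv : ~ h v.
      move=> hv; have : sep u p (~` h) by split=> //; exact: wallC.
      by rewrite pE => -[[_ _]].
    have [hv'|hv'] := pselect (h v'); first by left; right.
    have hu' : h u'.
      apply: contrapT => hu'; have : sep u' p' h by [].
      by rewrite pE' => -[[_ _]].
    right; right; exists (~` h); last exact: setCK.
    apply: (lem u' v' u v p' p) => //; first by split=> //; exact: wallC.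
    by split=> //; exact: wallC.
  have [hu'|hu'] := pselect (h u'); first by left; left.
  have [[_ _ hv'] _] : sep u' v' h /\ ~ level u' v' n h.
    suff : sep u' p' h by rewrite pE'.
    by [].
  have [hv|hv] := pselect (h v); last by left; right.
  by right; left; apply: (lem u v u' v' p p') => //; rewrite nb_sepC.
have fS : finite_set (sep u u' `|` sep v v') by rewrite finite_setU.
have fI : finite_set (setC @` B u v) by exact: finite_image.
apply: leq_trans (nb_setU fS _) _; first by rewrite finite_setU.
have := nb_setU (finite_sep u u') (finite_sep v v').
have := nb_setU (fB u' v') fI.
have := nb_image_le (@setC V) (fB u v).
have := BD u v; have := BD u' v'; nia.
Qed.

(** Passing from [p] to [p'] crosses halfspaces of one exact level only. *)
Lemma nb_normal_vertexS u v n p p' :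
  normal_vertex u v n p -> normal_vertex u v n.+1 p' -> nb (sep p p') <= D.
Proof.
rewrite /normal_vertex => pE pE'; have := nb_levels u v n 1; rewrite mul1n addn1.
apply: leq_trans; apply: nb_sub.
  by apply: sub_finite_set (finite_sep u v) => h [].
move=> h [Wh hp hp'].
have hu : ~ h u.
  move=> hu; have : sep u p (~` h) by split=> //; exact: wallC.
  rewrite pE => -[uvh l].
  suff : sep u p' (~` h) by case.
  by rewrite pE'; split=> // /levelS.
have [uvh l] : sep u v h /\ ~ level u v n.+1 h.
  suff : sep u p' h by rewrite pE'.
  by [].
split=> //; apply: contrapT => l'; suff [] : sep u p h by [].
by rewrite pE.
Qed.

End BoundedDegree.

(** * Equivariance of normal cube paths *)

Definition wall_automorphism (f : V -> V) :=
  bijective f /\ forall h, W h <-> W (f @^-1` h).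

Section Automorphism.
Variable f : V -> V.
Hypothesis autf : wall_automorphism f.

Lemma wall_preimageP k : W k -> exists2 h, W h & k = f @^-1` h.
Proof.
case: autf => -[g fK gK] Wf Wk; have kE : k = f @^-1` (g @^-1` k).
  by apply/seteqP; split=> x; rewrite /preimage /= fK.
by exists (g @^-1` k) => //; apply/Wf; rewrite -kE.
Qed.

Lemma preimage_inj : injective (preimage f : set V -> set V).
Proof.
case: autf => -[g fK gK] _ h k hk; apply/seteqP; split=> x hx;
  have /= := congr1 (fun A : set V => A (g x)) hk; rewrite /preimage /= gK.
  by move=> <-.
by move=> ->.
Qed.

Lemma sep_automorphism u v h : sep (f u) (f v) h <-> sep u v (f @^-1` h).
Proof.
by case: autf => _ Wf; split=> -[/(Wf h) Wh hu hv].
Qed.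

Lemma nb_sep_automorphism u v : nb (sep (f u) (f v)) = nb (sep u v).
Proof.
rewrite -(nb_image (f := preimage f) (finite_sep (f u) (f v))); last first.
  by move=> *; exact: preimage_inj.
congr nb; apply/seteqP; split=> [_ [h /sep_automorphism uvh <-]//|k uvk].
have [h Wh kE] : exists2 h, W h & k = f @^-1` h by apply: wall_preimageP; case: uvk.
by exists h; [apply/sep_automorphism; rewrite -kE|].
Qed.

Lemma level_automorphism u v n h :
  level (f u) (f v) n h <-> level u v n (f @^-1` h).
Proof.
elim: n h => // n IH h; split=> -[h' [uvh' hh' ne lev]].
  have {}lev := (IH h').1 lev; exists (f @^-1` h'); split=> //; first exact/sep_automorphism.
    by move=> x /hh'.
  by move/preimage_inj.
have [k Wk h'E] : exists2 k, W k & h' = f @^-1` k by apply: wall_preimageP; case: uvh'.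
exists k; split.
- by apply/sep_automorphism; rewrite -h'E.
- case: autf => -[g fK gK] _ x hx; have := hh' (g x); rewrite h'E /preimage /= gK; exact.
- by move=> hk; apply: ne; rewrite h'E hk.
- by apply/(IH k); rewrite -h'E.
Qed.

Lemma normal_vertex_automorphism u v n p :
  normal_vertex u v n p -> normal_vertex (f u) (f v) n (f p).
Proof.
rewrite /normal_vertex => pE; apply/seteqP; split=> h.
  move/sep_automorphism; rewrite pE => -[uvh l].
  by split; [exact/sep_automorphism|move/level_automorphism].
move=> [/sep_automorphism uvh l]; apply/sep_automorphism; rewrite pE; split=> //.
by move/level_automorphism.
Qed.

End Automorphism.
End Walls.

(** * Cubes and squares *)

Definition flip n (i : 'I_n) (e : {ffun 'I_n -> bool}) : {ffun 'I_n -> bool} :=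
  [ffun j => (j == i) (+) e j].

Lemma flipC n (i j : 'I_n) e : flip i (flip j e) = flip j (flip i e).
Proof. by apply/ffunP => k; rewrite !ffunE addbCA. Qed.

Lemma flipK n (i : 'I_n) : involutive (flip i).
Proof. by move=> e; apply/ffunP => k; rewrite !ffunE addbA addbb. Qed.

Lemma flip_neq n (i : 'I_n) e : flip i e <> e.
Proof. by move/ffunP/(_ i); rewrite ffunE eqxx; case: (e i). Qed.

Lemma flip_eq n (i j : 'I_n) e : flip i e = flip j e -> i = j.
Proof.
move/ffunP/(_ i); rewrite !ffunE eqxx; have [->//|_] := eqVneq i j.
by case: (e i).
Qed.

Section CubeGeometry.
Variable X : cube_complex.
Implicit Types (u v w t : X) (c : set X).

Lemma adjP u v : adjacent u v <-> u <> v /\ cube [set u; v].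
Proof. by split => /asboolP. Qed.

Lemma adjC u v : adjacent u v = adjacent v u.
Proof. by apply/idP/idP => /adjP[ne c]; apply/adjP; split=> [/esym//|]; rewrite setUC. Qed.

Lemma adj_neq u v : adjacent u v -> u <> v.
Proof. by case/adjP. Qed.

Lemma square_adj u v w t : square_boundary u v w t ->
  [/\ adjacent u v, adjacent v w, adjacent w t & adjacent t u].
Proof. by case=> _ _ _ /= /and5P[]. Qed.

Lemma square_rot u v w t : square_boundary u v w t -> square_boundary v w t u.
Proof.
move=> s; have [uv vw wt tu] := square_adj s; case: s => c uw vt _; split=> //.
- rewrite (_ : _ `|` _ = [set u; v] `|` [set w; t]) //.
  by apply/seteqP; split=> x /=; tauto.
- by move/esym.
- by rewrite /= uv vw wt tu.
Qed.

Lemma square_sym u v w t : square_boundary u v w t -> square_boundary u t w v.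
Proof.
move=> s; have [uv vw wt tu] := square_adj s; case: s => c uw vt _; split=> //.
- rewrite (_ : _ `|` _ = [set u; v] `|` [set w; t]) //.
  by apply/seteqP; split=> x /=; tauto.
- by move/esym.
- by rewrite /= adjC tu adjC wt adjC vw adjC uv.
Qed.

Section Coordinates.
Variables (c : set X) (n : nat) (f : {ffun 'I_n -> bool} -> X).
Hypothesis finj : injective f.
Hypothesis fc : range f = c.
Hypothesis faces : forall a, a `<=` c -> (cube a <-> exists s, a = f @` cube_face s).

Lemma face_cube s : cube (f @` cube_face s).
Proof. by apply/faces; [rewrite -fc; exact: image_subset|exists s]. Qed.

Lemma adj_flip i e : adjacent (f e) (f (flip i e)).
Proof.
apply/adjP; split=> [/finj/esym|]; first exact: flip_neq.
rewrite (_ : [set _; _] = f @` cube_face [ffun j => if j == i then None else Some (e j)]).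
  exact: face_cube.
apply/seteqP; split=> [x [->|->]|x [y yF <-]].
- by exists e => // j b; rewrite ffunE; case: ifP => // _ [].
- by exists (flip i e) => // j b; rewrite !ffunE; case: ifP => // _ [].
have key j : j != i -> y j = e j.
  by move=> ji; apply: (yF j); rewrite ffunE (negbTE ji).
have [yi|yi] := eqVneq (y i) (e i); [left|right]; congr f; apply/ffunP => j.
  by have [->|/key] := eqVneq j i.
by rewrite ffunE; have [->|/key] := eqVneq j i; [move: yi; case: (y i) (e i) => [] []|].
Qed.

Lemma square_flip i j e : i <> j ->
  square_boundary (f e) (f (flip i e)) (f (flip i (flip j e))) (f (flip j e)).
Proof.
move=> /eqP ij; split.
- rewrite (_ : [set _; _] `|` _ =
    f @` cube_face [ffun k => if (k == i) || (k == j) then None else Some (e k)]).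
    exact: face_cube.
  apply/seteqP; split=> [x [[|]|[|]] ->|x [y yF <-]].
  + by exists e => // k b; rewrite ffunE; case: ifP => // _ [].
  + by exists (flip i e) => // k b; rewrite !ffunE; case: eqP => // _; case: eqP => // _ [].
  + by exists (flip i (flip j e)) => // k b; rewrite !ffunE; case: eqP => // _; case: eqP => // _ [].
  + by exists (flip j e) => // k b; rewrite !ffunE; case: eqP => // _; case: eqP => // _ [].
  have key k : k != i -> k != j -> y k = e k.
    by move=> ki kj; apply: (yF k); rewrite ffunE (negbTE ki) (negbTE kj).
  have ji : (j == i) = false by rewrite eq_sym (negbTE ij).
  have [yi|yi] := eqVneq (y i) (e i); have [yj|yj] := eqVneq (y j) (e j).
  + left; left; congr f; apply/ffunP => k.
    by have [->//|ki] := eqVneq k i; have [->//|kj] := eqVneq k j; exact: key.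
  + right; right; congr f; apply/ffunP => k; rewrite !ffunE.
    have [->|kj] := eqVneq k j; first by move: yj; case: (y j) (e j) => [] [].
    by have [->//|ki] := eqVneq k i; exact: key.
  + left; right; congr f; apply/ffunP => k; rewrite !ffunE.
    have [->|ki] := eqVneq k i; first by move: yi; case: (y i) (e i) => [] [].
    by have [->//|kj] := eqVneq k j; exact: key.
  + right; left; congr f; apply/ffunP => k; rewrite !ffunE.
    have [->|ki] := eqVneq k i.
      by rewrite (negbTE ij); move: yi; case: (y i) (e i) => [] [].
    have [->|kj] := eqVneq k j; last exact: key.
    by move: yj; case: (y j) (e j) => [] [].
- move/finj/ffunP/(_ i); rewrite !ffunE eqxx (negbTE ij); by case: (e i).
- by move/finj/flip_eq/eqP; rewrite (negbTE ij).
- rewrite /= adj_flip /= adjC [flip i (flip j e)]flipC adjC adj_flip /= flipC.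
  by rewrite adjC adj_flip /= adjC adj_flip.
Qed.

(** The edge is a face. A face containing two vertices also contains the vertex got from the first
    by changing one coordinate in which they differ; as this face has two elements, that vertex is
    [w]. *)
Lemma adj_coordinates e w : c w -> adjacent (f e) w -> exists i, w = f (flip i e).
Proof.
move=> cw /adjP[ne cub].
have sub : [set f e; w] `<=` c by move=> x [->|->//]; rewrite -fc; exists e.
have [s sE] := (faces sub).1 cub.
have [e' e's e'E] : (f @` cube_face s) w by rewrite -sE; right.
have [e0 e0s /finj e0E] : (f @` cube_face s) (f e) by rewrite -sE; left.
subst e0.
have /existsP[i ei] : [exists i, e i != e' i].
  apply: contrapT => /negP; rewrite negb_exists => /forallP H; apply: ne.
  by rewrite -e'E; congr f; apply/ffunP => i; apply/eqP; move: (H i); rewrite negbK.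
exists i.
have : (f @` cube_face s) (f (flip i e)).
  exists (flip i e) => // j b sj; rewrite ffunE; have [ji|_] := eqVneq j i; last exact: e0s.
  by move: ei; rewrite -ji (e0s _ _ sj) (e's _ _ sj) eqxx.
by rewrite -sE => -[/finj/flip_neq//|->].
Qed.

End Coordinates.

(** Otherwise the two squares would meet in exactly three vertices, and no cube has three
    vertices. *)
Lemma square_unique u v w t t' :
  square_boundary u v w t -> square_boundary u v w t' -> t = t'.
Proof.
move=> s s'; apply: contrapT => tt'.
have [uv vw wt tu] := square_adj s; have [_ _ wt' tu'] := square_adj s'.
have uw : u <> w by case: s.
have vt : v <> t by case: s.
have vt' : v <> t' by case: s'.
have : cube (([set u; v] `|` [set w; t]) `&` ([set u; v] `|` [set w; t'])).
  apply: cubeI; [by case: s|by case: s'|by exists u; split; left; left].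
rewrite (_ : _ `&` _ = [set u; v] `|` [set w]); last first.
  apply/seteqP; split=> x /= => [[[|[]]]|]; try tauto.
  by move=> -> [|[|/tt']] //; [tauto|move=> wt''; move: wt; rewrite wt'' => /adj_neq].
case/cubeP => n [f [finj fc faces]].
have [e _ eu] : range f u by rewrite fc; left; left.
have [i vE] : exists i, v = f (flip i e).
  by apply: (adj_coordinates finj fc faces); [left; right|rewrite eu].
have [j wE] : exists j, w = f (flip j (flip i e)).
  by apply: (adj_coordinates finj fc faces); [right|rewrite -vE].
have ij : i <> j by move=> ij; apply: uw; rewrite wE ij flipK eu.
have : range f (f (flip j e)) by exists (flip j e).
rewrite fc -eu vE wE => -[[]|] /finj.
- exact: flip_neq.
- by move/flip_eq/esym.
- by rewrite flipC => /esym; exact: flip_neq.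
Qed.

Section Flag.
Hypothesis npc : nonpositively_curved X.
Hypothesis triangle_free : forall u v w, adjacent u v -> adjacent v w -> ~~ adjacent u w.

Lemma link_edge u v : adjacent u v -> link u [set v; v].
Proof.
move=> uv; exists [set u; v]; first by case/adjP: uv.
split; first by left.
rewrite setUid; apply/seteqP; split=> [x ->|x [[->|->]//]]; first by split=> //; right.
by move/adj_neq.
Qed.

(** Absence of triangles keeps the opposite corner [w] out of the link. *)
Lemma link_square u v w t : square_boundary u v w t -> link u [set v; t].
Proof.
move=> s; have [uv vw wt tu] := square_adj s; exists ([set u; v] `|` [set w; t]).
  by case: s.
split; first by left; left.
apply/seteqP; split=> [x [|] ->|x [[[]|[]] -> //]]; rewrite ?(adjC u t).
- by split=> //; left; right.
- by split; [right; right|rewrite adjC].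
- by move/adj_neq.
- by left.
- by move=> uw; have := triangle_free uv vw; rewrite uw.
- by right.
Qed.

(** The three neighbours of [a] are pairwise joined in its link, hence span a simplex, which comes
    from a cube. Uniqueness of squares identifies the given corners with those of the cube, and [t]
    is the vertex opposite to [a]. *)
Lemma three_squares_cube a b1 b2 b3 (c12 c13 c23 : X) : b1 <> b2 -> b1 <> b3 -> b2 <> b3 ->
  square_boundary a b1 c12 b2 -> square_boundary a b1 c13 b3 -> square_boundary a b2 c23 b3 ->
  exists t, [/\ square_boundary b1 c12 t c13, square_boundary b2 c12 t c23 &
    square_boundary b3 c13 t c23].
Proof.
move=> n12 n13 n23 s12 s13 s23.
have [ab1 _ _ _] := square_adj s12; have [ab2 _ _ ab3] := square_adj s23.
rewrite adjC in ab3.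
have [c cub [ca bE]] : link a ([set b1; b2] `|` [set b3]).
  apply: npc; first by rewrite !finite_setU; do !split; exact: finite_set1.
  move=> u u' [[]|] -> [[]|] ->; try exact: link_edge.
  - exact: link_square s12.
  - exact: link_square s13.
  - exact: link_square (square_sym s12).
  - exact: link_square s23.
  - exact: link_square (square_sym s13).
  - exact: link_square (square_sym s23).
have [n [f [finj fc faces]]] := cubeP cub.
have [e _ ea] : range f a by rewrite fc.
have coord b : ([set b1; b2] `|` [set b3]) b -> exists i, b = f (flip i e).
  rewrite bE => -[cb ab]; apply: (adj_coordinates finj fc faces) => //.
  by rewrite ea.
have [i1 E1] : exists i, b1 = f (flip i e) by apply: coord; left; left.
have [i2 E2] : exists i, b2 = f (flip i e) by apply: coord; left; right.
have [i3 E3] : exists i, b3 = f (flip i e) by apply: coord; right.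
have i12 : i1 <> i2 by move=> i12; apply: n12; rewrite E1 i12.
have i13 : i1 <> i3 by move=> i13; apply: n13; rewrite E1 i13.
have i23 : i2 <> i3 by move=> i23; apply: n23; rewrite E2 i23.
have corner i j x : i <> j -> square_boundary a (f (flip i e)) x (f (flip j e)) ->
    x = f (flip i (flip j e)).
  move=> ij s; apply: (square_unique (u := f (flip j e)) (v := a) (w := f (flip i e))).
    exact/square_rot/square_rot/square_rot.
  by rewrite -ea; do 3!apply: square_rot; exact: (square_flip finj fc faces).
subst b1 b2 b3.
rewrite (corner _ _ _ i12 s12) (corner _ _ _ i13 s13) (corner _ _ _ i23 s23).
exists (f (flip i1 (flip i2 (flip i3 e)))); split.
- have -> : flip i1 (flip i2 (flip i3 e)) = flip i2 (flip i3 (flip i1 e)).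
    by rewrite (flipC i1 i2) (flipC i1 i3).
  rewrite (flipC i1 i2) (flipC i1 i3); exact: (square_flip finj fc faces).
- have -> : flip i1 (flip i2 (flip i3 e)) = flip i1 (flip i3 (flip i2 e)).
    by rewrite (flipC i2 i3).
  rewrite (flipC i2 i3); exact: (square_flip finj fc faces).
- exact: (square_flip finj fc faces).
Qed.

End Flag.
End CubeGeometry.

(** * Reduced paths and the universal cover *)

Section ReducedPaths.
Variable X : cube_complex.
Hypothesis npc : nonpositively_curved X.
Hypothesis triangle_free :
  forall u v w : X, adjacent u v -> adjacent v w -> ~~ adjacent u w.
Variable o : X.
Implicit Types (p q r s : seq X) (z : X).
Local Notation sq := square_boundary.
Local Notation "p .end" := (head o p) (at level 2, format "p .end").

(* Edge paths issuing from [o] are listed backwards, so that the head of the list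
   is the endpoint of the path. *)

(* Under the intended [E], this says that [p] followed by [z] is again reduced. *)
Definition extends (E : seq X -> seq X -> Prop) p z :=
  [/\ E p p, adjacent p.end z & ~ exists2 r, r.end = z & E (p.end :: r) p].

Definition flip_extend (E : seq X -> seq X -> Prop) P Q :=
  exists z p q, [/\ P = z :: p, Q = z :: q, extends E p z, extends E q z &
    E p q \/ exists r, [/\ E (p.end :: r) p, E (q.end :: r) q &
                           sq r.end p.end z q.end]].

(* Equivalence of reduced paths of length [n] under flips across squares, as a
   partial equivalence relation: [p] is reduced iff [feq n p p]. *)
Fixpoint feq n : seq X -> seq X -> Prop :=
  if n is n'.+1 then flip_extend (feq n') else fun P Q => P = [:: o] /\ Q = [:: o].

Local Notation ext n := (extends (feq n)).
Local Notation below n p z := (exists2 r, r.end = z & feq n (p.end :: r) p).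

Lemma feq_sym n p q : feq n p q -> feq n q p.
Proof.
elim: n p q => [|n IH] P Q; first by case.
move=> [z [p [q [-> -> pz qz pq]]]]; exists z, q, p; split=> //.
case: pq => [/IH|[r [rp rq s]]]; [by left|right].
by exists r; split=> //; exact: square_sym.
Qed.

Lemma feq_end n p q : feq n p q -> p.end = q.end.
Proof. by case: n => [[-> ->]//|n [z [p' [q' [-> ->]]]]]. Qed.

Lemma feq_size n p q : feq n p q -> size p = n.+1 /\ size q = n.+1.
Proof.
elim: n p q => [p q [-> ->]//|n IH] P Q [z [p [q [-> -> [pp _ _] [qq _ _] _]]]] /=.
by have [-> _] := IH _ _ pp; have [-> _] := IH _ _ qq.
Qed.

Lemma extP n p z : feq n p p -> adjacent p.end z -> ext n p z \/ below n p z.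
Proof. by move=> pp pz; have [|b] := pselect (below n p z); [right|left]. Qed.

Lemma feq_cons n p z : ext n p z -> feq n.+1 (z :: p) (z :: p).
Proof. by move=> pz; exists z, p, p; split=> //; left; case: pz. Qed.

Lemma feq_consP n p q z : feq n.+1 (z :: p) (z :: q) ->
  [/\ ext n p z, ext n q z & feq n p q \/ exists r, [/\ feq n (p.end :: r) p,
     feq n (q.end :: r) q & sq r.end p.end z q.end]].
Proof. by case=> z' [p' [q' [[_ ->] [-> ->] ? ? ?]]]. Qed.

Lemma feqSP n P Q : feq n.+1 P Q -> flip_extend (feq n) P Q.
Proof. by []. Qed.

(** If [y] did not extend [a :: p], a flip at [a] would exhibit a square through [y], [a] and the
    end of [p]. By uniqueness its fourth corner is [b], so [b] would be below [p]. *)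
Lemma feq_square n p a y b : sq p.end a y b -> ext n p a -> ext n p b ->
  ext n.+1 (a :: p) y /\ feq n.+2 (y :: a :: p) (y :: b :: p).
Proof.
have up a' b' : sq p.end a' y b' -> ext n p a' -> ext n p b' -> ext n.+1 (a' :: p) y.
  move=> s pa [_ _ pb]; have [ua ay _ _] := square_adj s.
  split=> //; first exact: feq_cons.
  move=> [r ry /= /feq_consP[_ _ [rp|[t [tr tp s']]]]].
    by case: s => _ + _ _; rewrite -ry (feq_end rp).
  apply: pb; exists t => //; rewrite ry in s'.
  apply: (square_unique (u := y) (v := a') (w := p.end)).
    exact: square_rot s'.
  by apply: square_sym; do 2!apply: square_rot.
move=> s pa pb; have ya := up _ _ s pa pb; have yb := up _ _ (square_sym s) pb pa.
split=> //; exists y, (a :: p), (b :: p); split=> //; right; exists p.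
by split=> //; exact: feq_cons.
Qed.

(** Transitivity is proved by induction on the length, and the next lemmas serve in that induction;
    so they assume it at the lengths they need. *)
Definition feq_trans_at n := forall p q r, feq n p q -> feq n q r -> feq n p r.

Lemma ext_congr n p q z : feq_trans_at n -> feq n p q -> ext n p z -> ext n q z.
Proof.
move=> tr pq [pp pz nb]; have qp := feq_sym pq; split; first exact: tr pq.
  by rewrite -(feq_end pq).
by move=> [r rz rq]; apply: nb; exists r => //; rewrite (feq_end pq); exact: tr qp.
Qed.

Lemma feq_congr n p q z : feq_trans_at n -> feq n p q -> ext n p z ->
  feq n.+1 (z :: p) (z :: q).
Proof.
move=> tr pq pz; exists z, p, q; split=> //; last by left.
exact: ext_congr pz.
Qed.

(** Suppose [y] is below [r], reached by [q]. If [a] extends [q], then [feq_square] at [q] puts [a]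
    below [p]. If [a] is below [q], the induction hypothesis at [q] puts the end of [p] below [r].
    Either is absurd, so [y] extends [r] and [feq_square] applies at [r]. *)
Lemma feq_square_below n p a y b r : (forall k, k <= n.+2 -> feq_trans_at k) ->
  sq p.end a y b -> ext n.+1 p a -> r.end = b -> feq n.+1 (p.end :: r) p ->
  ext n r y /\ feq n.+2 (a :: y :: r) (a :: p).
Proof.
elim/ltn_ind: n p a y b r => n IH p a y b r tr s pa rb rp.
have [ua ay yb bu] := square_adj s.
have tr1 : feq_trans_at n.+1 by apply: tr.
have tr0 : feq_trans_at n by apply: tr; lia.
have rr : ext n r p.end.
  by case/feq_consP: (tr1 _ _ _ rp (feq_sym rp)).
have ry : ext n r y.
  have [rr' _ _] := rr; have [|//|[q qy qr]] := extP (n := n) (p := r) (z := y) rr'.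
    by rewrite rb adjC.
  case: n => [|k] in IH tr pa rp tr1 tr0 rr rr' qr *.
    (* At length 0 the list [q] is empty and its end is the default value [o], so [y] would equal
       the end of [r], to which it is adjacent. *)
    case: qr => -[be qe] re; move: qy; rewrite qe /= => oy.
    by case: s => _ _ + _; move: yb; rewrite -oy -be rb => /adj_neq.
  have qb : ext k q b.
    by rewrite rb in qr; case/feq_consP: (tr0 _ _ _ qr (feq_sym qr)).
  have s' : sq q.end b p.end a.
    by rewrite qy; do 2!apply: square_rot.
  have [qq _ _] := qb.
  have [|qa|[t ta tq]] := extP (z := a) qq; first by rewrite qy adjC.
    have [_ H] := feq_square s' qb qa.
    exfalso; case: pa => _ _; apply; exists (a :: q) => //.
    apply: (tr1 _ _ _ _ rp); apply: (tr1 _ _ _ (feq_sym H)).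
    apply: feq_congr => //; first by rewrite -rb.
    by apply: ext_congr rr => //; apply: feq_sym; rewrite -rb.
  case: k => [|j] in IH tr pa rp tr1 tr0 rr rr' qr qb qq tq *.
    case: tq => -[qo to] qE; move: qo ta; rewrite to qE /= => _ oa.
    by move: ay; rewrite -oa -qy qE => /adj_neq.
  have jn : j < j.+2 by lia.
  have trj k : k <= j.+2 -> feq_trans_at k by move=> kj; apply: tr; lia.
  have [t1 t2] := IH j jn q b p.end a t trj s' qb ta tq.
  exfalso; case: rr => _ _; apply; exists (p.end :: t) => //.
  by rewrite rb; rewrite rb in qr; exact: tr0 t2 qr.
split=> //.
have s' : sq r.end p.end a y by rewrite rb; do 3!apply: square_rot.
have [ra H] := feq_square s' rr ry.
apply: (tr _ _ _ (a :: p.end :: r)) => //; first exact: feq_sym.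
exact: feq_congr.
Qed.

(** The essential case is that of two flips at [z], whose squares share the edge from [z] to the end
    of [p1]. Both [r0] and [r1] precede [p1]; if they are not equivalent, a third square at the end
    of [p1] relates them, and the three squares span a 3-cube. Its vertex [t] opposite to the end of
    [p1] is the lower corner of a square that relates [p0] and [p2] directly. *)
Lemma feq_transitive n : feq_trans_at n.
Proof.
elim/ltn_ind: n => -[_ p q r [-> ->] [_ ->]//|n] IH.
move=> P0 P1 P2 /feqSP[z [p0 [p1 [-> -> e0 e1 h01]]]].
move=> /feqSP[_ [_ [p2 [[<- <-] -> _ e2 h12]]]].
exists z, p0, p2; split=> //.
have tr : feq_trans_at n by exact: IH.
case: h01 => [p01|[r0 [r00 r01 s0]]].
  case: h12 => [p12|[r [r1 r2 s]]]; first by left; exact: tr p12.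
  right; exists r; rewrite (feq_end p01); split=> //.
  exact: tr (feq_sym p01).
case: h12 => [p12|[r1 [r11 r12 s1]]].
  right; exists r0; rewrite -(feq_end p12); split=> //; exact: tr p12.
have rr : feq n (p1.end :: r0) (p1.end :: r1) by apply: tr r01 (feq_sym r11).
case: n => [|m] in IH tr e0 e1 e2 r00 r01 r11 r12 rr *.
  by case: r00 r01 => [[e00 _] _] [[e01 _] _]; case: s0 => _ _; rewrite e00 e01.
have trm : feq_trans_at m by exact: IH.
have [_ _ h] := feq_consP rr.
have u0r0 : ext m r0 p0.end by case/feq_consP: (tr _ _ _ r00 (feq_sym r00)).
have u1r0 : ext m r0 p1.end by case/feq_consP: (tr _ _ _ r01 (feq_sym r01)).
have u1r1 : ext m r1 p1.end by case/feq_consP: (tr _ _ _ r11 (feq_sym r11)).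
have u2r1 : ext m r1 p2.end by case/feq_consP: (tr _ _ _ r12 (feq_sym r12)).
case: h => [h|[s [sr0 sr1 s2]]].
  have u02 : p0.end = p2.end.
    apply: (square_unique (u := z) (v := p1.end) (w := r0.end)).
      by do 2!apply: square_rot.
    by rewrite (feq_end h); do 2!apply: square_rot; exact: square_sym.
  left; apply: (tr _ _ _ (feq_sym r00)); apply: tr r12.
  by rewrite -u02; exact: feq_congr.
case: m => [|k] in IH tr e0 e1 e2 r00 r01 r11 r12 rr u0r0 u1r0 u1r1 u2r1 trm sr0 sr1 *.
  by case: sr0 sr1 => [[e00 _] _] [[e01 _] _]; case: s2 => _ _; rewrite e00 e01.
have x0s : ext k s r0.end by case/feq_consP: (trm _ _ _ sr0 (feq_sym sr0)).
have x1s : ext k s r1.end by case/feq_consP: (trm _ _ _ sr1 (feq_sym sr1)).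
have ss : feq k s s by case: x0s.
have [t [tz t0 t1]] : exists t, [/\ sq z p0.end t p2.end, sq r0.end p0.end t s.end &
    sq r1.end p2.end t s.end].
  apply: (three_squares_cube npc triangle_free (a := p1.end)).
  - by case: s0 => _ x0z _ _ zx; exact: x0z.
  - by case: s1 => _ x1z _ _ zx; exact: x1z.
  - by case: s2.
  - by apply: square_rot; exact: square_sym.
  - exact: square_rot.
  - by do 2!apply: square_rot; exact: square_sym.
(* If [t] were below [s], then by [feq_square_below] the end of [p0] would be below [r0], which it
   extends. *)
have st : ext k s t.
  have [|//|[s' ts' s's]] := extP (z := t) ss; first by rewrite adjC; case/square_adj: t0.
  have sy : sq s.end r0.end p0.end t by exact/square_rot/square_rot/square_rot.
  case: k => [|j] in IH tr e0 e1 e2 r00 r01 r11 r12 rr u0r0 u1r0 u1r1 u2r1 trm sr0 sr1 x0s x1s ss s's *.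
    case: s's => -[so s'0] sE; move: ts'; rewrite s'0 /= => ot.
    by case/square_adj: t0 => _ _; rewrite -ot so => /adj_neq.
  have [|h1 h2] := feq_square_below _ sy x0s ts' s's.
    by move=> i ij; apply: IH; lia.
  exfalso; case: u0r0 => _ _; apply; exists (p0.end :: s') => //.
  exact: trm h2 sr0.
have sy : sq s.end r0.end p0.end t by exact/square_rot/square_rot/square_rot.
have sy' : sq s.end r1.end p2.end t by exact/square_rot/square_rot/square_rot.
have [_ H0] := feq_square sy x0s st.
have [_ H2] := feq_square sy' x1s st.
right; exists (t :: s); split=> //=.
- apply: (tr _ _ _ (feq_sym H0)); apply: tr r00; apply: feq_congr => //.
  by apply: ext_congr u0r0 => //; exact: feq_sym.
- apply: (tr _ _ _ (feq_sym H2)); apply: tr r12; apply: feq_congr => //.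
  by apply: ext_congr u2r1 => //; exact: feq_sym.
- by do 2!apply: square_rot; exact: square_sym.
Qed.

Lemma feq_trans n p q r : feq n p q -> feq n q r -> feq n p r.
Proof. exact: feq_transitive. Qed.

Definition eqv p q := exists n, feq n p q.

Lemma eqv_sym p q : eqv p q -> eqv q p.
Proof. by case=> n /feq_sym; exists n. Qed.

Lemma eqv_level n p q : feq n p p \/ feq n q q -> eqv p q -> feq n p q.
Proof.
move=> h [m pq]; suff <- : m = n by [].
have [sp sq] := feq_size pq.
by case: h => /feq_size [+ _]; rewrite (sp, sq) => -[].
Qed.

Lemma feq_refl n p q : feq n p q -> feq n p p.
Proof. by move=> pq; exact: (feq_trans pq (feq_sym pq)). Qed.

Lemma eqv_refl p q : eqv p q -> eqv p p.
Proof. by case=> n /feq_refl; exists n. Qed.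

Lemma eqv_trans p q r : eqv p q -> eqv q r -> eqv p r.
Proof.
move=> [n pq] qr; exists n; apply: (feq_trans pq); apply: eqv_level qr; left.
exact: feq_refl (feq_sym pq).
Qed.

Lemma eqv_end p q : eqv p q -> p.end = q.end.
Proof. by case=> n /feq_end. Qed.

Lemma eqv_ext p v q : eqv p p -> eqv (v :: p) q -> exists n, ext n p v.
Proof.
move=> [m pp] [n pq]; have [sp _] := feq_size pp; have [/= [spn] _] := feq_size pq.
rewrite -spn sp in pq; exists m.
by case/feq_consP: (feq_refl pq).
Qed.

Lemma eqv_cons n p q v : ext n p v -> eqv p q -> eqv (v :: p) (v :: q).
Proof.
move=> pv pq; exists n.+1; apply: feq_congr => //; first exact: feq_transitive.
by apply: eqv_level pq; left; case: pv.
Qed.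

(* Reduced paths up to [eqv] are the vertices of the universal cover, and [step]
   lifts edges to it. *)
Definition step p v q :=
  [/\ adjacent p.end v, q.end = v, eqv p p, eqv q q & eqv (v :: p) q \/ eqv (p.end :: q) p].

Lemma step_sym p v q : step p v q -> step q p.end p.
Proof.
case=> pv qv pp qq h; subst v; split=> //; first by rewrite adjC.
by case: h => ?; [right|left].
Qed.

Lemma step_exists p v : eqv p p -> adjacent p.end v -> exists q, step p v q.
Proof.
move=> pp pv; have [n pn] := pp.
have [pnv|[r rv rp]] := extP pn pv.
  have vp := feq_cons pnv.
  by exists (v :: p); split=> //; [exists n.+1|left; exists n.+1].
exists r; split=> //; last by right; exists n.
case: n => [|n] in pn rp *; last first.
  by case/feq_consP: (feq_refl rp) => -[rr _ _] _ _; exists n.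
by case: rp => -[po ro] _; move: pv; rewrite -rv ro /= po => /adj_neq.
Qed.

Lemma step_congr p v q p' q' : step p v q -> eqv p p' -> eqv q q' -> step p' v q'.
Proof.
move=> [pv qv pp qq h] p'E q'E; split.
- by rewrite -(eqv_end p'E).
- by rewrite -(eqv_end q'E).
- exact: eqv_refl (eqv_sym p'E).
- exact: eqv_refl (eqv_sym q'E).
- case: h => h; [left|right].
    have [n pn] := eqv_ext pp h.
    apply: (eqv_trans _ q'E); apply: (eqv_trans _ h).
    exact: eqv_sym (eqv_cons pn p'E).
  have [n pn] := eqv_ext qq h.
  apply: (eqv_trans _ p'E); apply: (eqv_trans _ h); rewrite -(eqv_end p'E).
  exact: eqv_sym (eqv_cons pn q'E).
Qed.

Lemma step_above p v q : step p v q -> eqv (v :: p) q -> exists n, ext n p v.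
Proof. by move=> [_ _ pp _ _]; exact: eqv_ext. Qed.

Lemma step_above_below p v q q' : step p v q -> eqv (v :: p) q -> q'.end = v ->
  eqv (p.end :: q') p -> False.
Proof.
move=> s h q'v h'; have [n [pp _ nb]] := step_above s h.
by apply: nb; exists q' => //; apply: eqv_level h'; right.
Qed.

(** A flip would need two different ends at opposite corners of a square. The empty list is excluded
    because its end is [o] by default, so that it would count as a predecessor of the constant
    path. *)
Lemma eqv_below p q q' : q <> [::] -> q.end = q'.end -> eqv (p.end :: q) p -> eqv (p.end :: q') p ->
  eqv q q'.
Proof.
move=> q0 qq' qp /eqv_sym/(eqv_trans qp) [[[[_ qE]]|n]]; first by move: q0; rewrite qE.
case/feq_consP => _ _ [|[r [_ _ [_ _]]]]; first by exists n.
by rewrite qq'.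
Qed.

Lemma eqv_nil : ~ eqv [::] [::].
Proof. by case=> n /feq_size[]. Qed.

Lemma step_uniq p v q q' : step p v q -> step p v q' -> eqv q q'.
Proof.
move=> s s'; have [_ qv pp qq [h|h]] := s; have [_ qv' _ qq' [h'|h']] := s'.
- exact: eqv_trans (eqv_sym h) h'.
- by case: (step_above_below s h qv' h').
- by case: (step_above_below s' h' qv h).
- by apply: eqv_below h h'; [move=> q0; move: qq; rewrite q0 => /eqv_nil|rewrite qv qv'].
Qed.

Lemma step_square_below p v q w r t q' r' : sq p.end v w t ->
  step p v q -> step q w r -> step p t q' -> step q' w r' ->
  eqv (v :: p) q -> eqv (p.end :: q') p -> eqv r r'.
Proof.
move=> s pq qr pq' q'r' h h'; have [n pv] := step_above pq h.
have [pp _ _] := pv; have [_ q't _ q'q' _] := pq'.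
have {}h' : feq n (p.end :: q') p by apply: eqv_level h'; right.
case: n => [|n] in pv pp h' *.
  by case: h' => -[_ q'0]; move: q'q'; rewrite q'0 => /eqv_nil.
have [|q'w H] := feq_square_below _ s pv q't h'; first by move=> k _; exact: feq_transitive.
have ww := feq_cons q'w.
have step1 : step q' w (w :: q').
  by split=> //; [case: q'w|exists n.+1|left; exists n.+1].
apply: (eqv_trans _ (step_uniq step1 q'r')); apply: step_uniq qr _.
case: pq => _ qv _ qq _; split=> //; first by rewrite qv; case/square_adj: s.
  by exists n.+1.
right; rewrite qv; apply: (eqv_trans _ h); by exists n.+2.
Qed.

(** The cases are whether [v] and [t] lead up or down from [p]. Both up is [feq_square], and one of
    each is [feq_square_below]. If both lead down, [q] and [q'] precede the same path by a flip, and
    the fourth corner of its square is [w] by uniqueness. *)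
Lemma step_square p v q w r t q' r' : sq p.end v w t ->
  step p v q -> step q w r -> step p t q' -> step q' w r' -> eqv r r'.
Proof.
move=> s pq qr pq' q'r'.
have [_ qv pp qq [h|h]] := pq; have [_ q't _ qq' [h'|h']] := pq'.
- have [n pv] := step_above pq h; have [m pt] := step_above pq' h'.
  have {}pt : ext n p t.
    suff <- : m = n by [].
    have [/feq_size[+ _] _ _] := pt; have [/feq_size[+ _] _ _] := pv.
    by move=> -> [].
  have [vw H] := feq_square s pv pt; have [tw _] := feq_square (square_sym s) pt pv.
  apply: (@eqv_trans _ (w :: v :: p)).
    apply: step_uniq qr _; apply: step_congr (_ : step (v :: p) w (w :: v :: p)) h _.
      split=> //; first by case/square_adj: s.
      - by exists n.+1; exact: feq_cons.
      - by exists n.+2; exact: feq_cons.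
      - by left; exists n.+2; exact: feq_cons.
    by exists n.+2; exact: feq_cons.
  apply: (@eqv_trans _ (w :: t :: p)); first by exists n.+2.
  apply: step_uniq q'r'; apply: step_congr (_ : step (t :: p) w (w :: t :: p)) h' _.
    split=> //; first by case/square_adj: (square_sym s).
    - by exists n.+1; exact: feq_cons.
    - by exists n.+2; exact: feq_cons.
    - by left; exists n.+2; exact: feq_cons.
  by exists n.+2; exact: feq_cons.
- exact: step_square_below pq qr pq' q'r' h h'.
- exact/eqv_sym/(step_square_below (square_sym s) pq' q'r' pq qr h' h).
- have [n H] := eqv_trans h (eqv_sym h').
  case: n => [|n] in H *.
    by case: H => -[_ q0]; move: qq; rewrite q0 => /eqv_nil.
  case/feq_consP: H => _ _ [/feq_end|[r0 [r0q r0q' s']]].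
    by rewrite qv q't; case: s.
  have r0w : r0.end = w.
    apply: (square_unique (u := q'.end) (v := p.end) (w := q.end)).
      by apply: square_rot; exact: square_sym.
    by rewrite qv q't; do 3!apply: square_rot.
  case: n => [|n] in r0q r0q' *.
    by case: r0q r0q' => [[qo _] _] [[q'o _] _]; case: s' => _ _; rewrite qo q'o.
  have r0r0 : eqv r0 r0.
    by case/feq_consP: (feq_refl r0q) => -[rr _ _] _ _; exists n.
  have [_ vw wt _] := square_adj s.
  have s1 : step q w r0.
    by split=> //; [rewrite qv|right; exists n.+1].
  have s2 : step q' w r0.
    by split=> //; [rewrite q't adjC|right; exists n.+1].
  exact: eqv_trans (step_uniq qr s1) (step_uniq s2 q'r').
Qed.

(** * Path lifting to the universal cover *)

Fixpoint lift p vs q : Prop :=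
  if vs is v :: ws then exists2 p', step p v p' & lift p' ws q else eqv p q.

Lemma lift_congr p p' q q' vs : eqv p p' -> eqv q q' -> lift p vs q -> lift p' vs q'.
Proof.
move=> pp' qq'; elim: vs p p' pp' => [|v vs IH] p p' pp' /=.
  by move=> pq; apply: (eqv_trans (eqv_sym pp')); exact: (eqv_trans pq).
move=> [r pr rq]; have [_ _ _ rr _] := pr.
by exists r; [exact: step_congr pr _ _|exact: IH rq].
Qed.

Lemma lift_refl p vs q : lift p vs q -> eqv p p /\ eqv q q.
Proof.
elim: vs p => [|v vs IH] p /=; last by case=> r [_ _ pp _ _] /IH[].
by move=> pq; split; [exact: eqv_refl pq|exact: eqv_refl (eqv_sym pq)].
Qed.

Lemma lift_cat p vs ws q :
  lift p (vs ++ ws) q <-> exists2 m, lift p vs m & lift m ws q.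
Proof.
elim: vs p => [|v vs IH] p /=; split.
- by move=> pq; exists p => //; case: (lift_refl pq).
- move=> [m pm mq]; apply: (lift_congr _ _ mq); first exact: eqv_sym.
  by case: (lift_refl mq).
- by move=> [r pr /IH[m rm mq]]; exists m => //; exists r.
- by move=> [m [r pr rm] mq]; exists r => //; apply/IH; exists m.
Qed.

Lemma lift_end p vs q : lift p vs q -> q.end = last p.end vs.
Proof.
elim: vs p => [|v vs IH] p /=; first by move/eqv_end.
by move=> [r [_ <- _ _ _] /IH].
Qed.

Lemma lift_path p vs q : lift p vs q -> path (@adjacent X) p.end vs.
Proof.
elim: vs p => [//|v vs IH] p /= [r [pv rv _ _ _] /IH rvs].
by rewrite pv -rv.
Qed.

Lemma lift_exists p vs : eqv p p -> path (@adjacent X) p.end vs -> exists q, lift p vs q.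
Proof.
elim: vs p => [|v vs IH] p pp /=; first by exists p.
move=> /andP[pv vvs]; have [r pr] := step_exists pp pv.
have [_ rv _ rr _] := pr.
have [|q rq] := IH r rr; first by rewrite rv.
by exists q, r.
Qed.

Lemma lift_uniq p vs q q' : lift p vs q -> lift p vs q' -> eqv q q'.
Proof.
elim: vs p q q' => [|v vs IH] p q q' /=.
  by move=> pq pq'; exact: (eqv_trans (eqv_sym pq)).
move=> [r pr rq] [r' pr' rq']; apply: (IH r) => //.
have [_ _ _ r'r' _] := pr'; apply: (lift_congr _ _ rq').
  exact: step_uniq pr' pr.
by case: (lift_refl rq').
Qed.

Lemma lift_inj p p' vs q : p.end = p'.end -> lift p vs q -> lift p' vs q -> eqv p p'.
Proof.
elim: vs p p' q => [|v vs IH] p p' q pp' /=.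
  by move=> pq p'q; exact: (eqv_trans pq (eqv_sym p'q)).
move=> [r pr rq] [r' pr' rq'].
have [_ rv pe re _] := pr; have [_ rv' pe' re' _] := pr'.
have rr' : eqv r r' by apply: IH rq rq'; rewrite rv rv'.
apply: step_uniq (step_sym pr) _; rewrite pp'.
exact: step_congr (step_sym pr') (eqv_sym rr') pe'.
Qed.

Lemma lift_rev p vs q : lift p vs q -> lift q (rev (belast p.end vs)) p.
Proof.
elim: vs p => [|v vs IH] p /=; first exact: eqv_sym.
move=> [r pr rq]; have [_ rv pp _ _] := pr.
rewrite rev_cons -cats1; apply/lift_cat; exists r; last first.
  by exists p => //; exact: step_sym pr.
by rewrite -rv; exact: IH.
Qed.

Lemma lift_backtrack m v q : adjacent m.end v -> eqv m m ->
  lift m [:: v; m.end] q <-> eqv m q.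
Proof.
move=> mv mm; have [a ma] := step_exists mm mv; have am := step_sym ma.
have [_ _ _ aa _] := ma.
split=> [[a' ma' [b ab bq]]|mq]; last first.
  by exists a => //; exists m.
apply: (eqv_trans _ bq); apply: step_uniq am _.
have [_ _ _ bb _] := ab.
exact: step_congr ab (step_uniq ma' ma) bb.
Qed.

Lemma lift_square m v w t q : sq m.end v w t -> eqv m m ->
  lift m [:: v; w; t; m.end] q <-> eqv m q.
Proof.
move=> s mm; have [mv vw wt tm] := square_adj s.
have [a ma] := step_exists mm mv; have [_ av _ aa _] := ma.
have [|b ab] := step_exists (p := a) (v := w) aa; first by rewrite av.
have [_ bw _ bb _] := ab.
have [|c mc] := step_exists (v := t) mm; first by rewrite adjC.
have [_ ct _ cc _] := mc.
have [|b' cb'] := step_exists (p := c) (v := w) cc; first by rewrite ct adjC.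
have bb' := step_square s ma ab mc cb'.
have bc : step b t c.
  by rewrite -ct; apply: step_sym; exact: step_congr cb' cc (eqv_sym bb').
have mE : lift m [:: v; w; t; m.end] m.
  by exists a => //; exists b => //; exists c => //; exists m => //; exact: step_sym mc.
split=> [mq|mq]; first exact: lift_uniq mE mq.
exact: lift_congr mm mq mE.
Qed.

(** Homotopies relate arbitrary vertex sequences, so lifting is made a relation on all of them; it
    fails for those that are not edge paths from [o]. *)
Definition lift_from_base (S : seq X) q := if S is x :: vs then x = o /\ lift [:: o] vs q else False.

Lemma eqv_base : eqv [:: o] [:: o].
Proof. by exists 0. Qed.

(** With [loop] a backtrack or the boundary of a square, this is the invariance of lifts under one
    elementary homotopy. *)
Lemma lift_loop_homotopy (p loop ws : seq X) u q :
  (forall m q', m.end = u -> eqv m m -> lift m loop q' <-> eqv m q') ->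
  lift_from_base (p ++ u :: loop ++ ws) q <-> lift_from_base (p ++ u :: ws) q.
Proof.
move=> loopE; case: p => [|x p] /=.
  split=> -[uo L]; split=> //; subst u; move: L; last first.
    by move=> L; apply/lift_cat; exists [:: o] => //; apply/loopE => //; exact: eqv_base.
  move=> /lift_cat[m om mq].
  have {}om : eqv [:: o] m by apply/loopE => //; exact: eqv_base.
  apply: (lift_congr (eqv_sym om) _ mq); by case: (lift_refl mq).
rewrite -[u :: loop ++ ws]cat1s -[u :: ws]cat1s !catA -catA.
split=> -[xo /lift_cat[m om mq]]; split=> //; apply/lift_cat; exists m => //.
  have [_ mm] := lift_refl om.
  have mu : m.end = u by rewrite (lift_end om) last_cat.
  move: mq => /lift_cat[m' /(loopE _ _ mu mm) mm' m'q].
  apply: (lift_congr (eqv_sym mm') _ m'q); by case: (lift_refl m'q).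
have [_ mm] := lift_refl om.
have mu : m.end = u by rewrite (lift_end om) last_cat.
by apply/lift_cat; exists m => //; exact/loopE.
Qed.

Lemma lift_homotopic (S S' : seq X) q : homotopic S S' -> lift_from_base S q <-> lift_from_base S' q.
Proof.
elim=> [{}S {}S' [p ws u v uv|p ws u v w t s]|{}S|{}S {}S' _ ->|R S1 S2 _ -> _ ->] //.
  apply: (@lift_loop_homotopy _ [:: v; u]) => // m q' mu mm.
  by rewrite -mu; apply: lift_backtrack; rewrite ?mu.
apply: (@lift_loop_homotopy _ [:: v; w; t; u]) => // m q' mu mm.
by rewrite -mu; apply: lift_square; rewrite ?mu.
Qed.

Hypothesis sc : simply_connected X.

Lemma reduced_path n p : feq n p p ->
  exists vs, [/\ path (@adjacent X) o vs, size vs = n, last o vs = p.end & lift [:: o] vs p].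
Proof.
suff : feq n p p -> exists2 vs, size vs = n & lift [:: o] vs p.
  move=> H /H[vs vsn L]; exists vs; split=> //; first exact: lift_path L.
  by rewrite (lift_end L).
elim: n p => [p [-> _]|n IH p]; first by exists [::] => //; exact: eqv_base.
move=> /feqSP[z [q [_ [-> _ qz _ _]]]]; have [qq _ _] := qz.
have [vs vsn L] := IH q qq; exists (vs ++ [:: z]); first by rewrite size_cat /= addn1 vsn.
apply/lift_cat; exists q => //; have zz := feq_cons qz.
exists (z :: q); last by exists n.+1.
by split=> //; [case: qz|exists n|exists n.+1|left; exists n.+1].
Qed.

(** Following [p] and then [q] backwards is a loop, which is null-homotopic, so its lift closes up.
    Hence the reverse of [q] lifts to a path ending at [[:: o]] from both [p] and [q], and
    [lift_inj] applies. *)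
Lemma reduced_unique p q : eqv p p -> eqv q q -> p.end = q.end -> eqv p q.
Proof.
move=> [n pp] [m qq] pq.
have [vs [vsp _ vse Lp]] := reduced_path pp; have [ws [wsp _ wse Lq]] := reduced_path qq.
have Lr := lift_rev Lq.
have [|r Pr] := lift_exists (p := p) (vs := rev (belast o ws)) (ex_intro _ n pp).
  by rewrite pq; exact: lift_path Lr.
have Lo : lift [:: o] (vs ++ rev (belast o ws)) r by apply/lift_cat; exists p.
have or : eqv [:: o] r.
  have [_ /(_ o _ (lift_path Lo)) H] := sc.
  have /H/(lift_homotopic r)[] : last o (vs ++ rev (belast o ws)) = o.
    rewrite last_cat vse pq; have := lift_end Lr; by move=> /= <-.
  by move=> /(_ (conj erefl Lo)) [_].
apply: (lift_inj pq) (Lr); apply: lift_congr Pr; first by exists n.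
exact: eqv_sym.
Qed.

Lemma size_path_lift vs p q : lift p vs q -> size q <= size p + size vs.
Proof.
elim: vs p => [|v vs IH] p /=; first by case=> n /feq_size[-> ->]; rewrite addn0.
move=> [r [_ _ _ _ h] /IH]; suff : size r <= (size p).+1 by lia.
by case: h => -[n /feq_size[]] /=; lia.
Qed.
End ReducedPaths.

(** * The median graph of a CAT(0) cube complex *)

Section Distance.
Variable X : cube_complex.
Hypothesis cat0 : CAT0 X.
Implicit Types o u v w z : X.

Let sc : simply_connected X := proj1 cat0.
Let npc : nonpositively_curved X := proj2 cat0.

Lemma homotopic_odd (S S' : seq X) : homotopic S S' -> odd (size S) = odd (size S').
Proof.
elim=> [_ _ [p q u v _|p q u v w t _]|//|//|S1 S2 S3 _ -> _ ->//].
all: by rewrite !size_cat /= ?addnS /= ?negbK.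
Qed.

(** Elementary homotopies change lengths by 2 or 4, so a closed path of length 3 is not
    null-homotopic. *)
Lemma triangle_free u v w : adjacent u v -> adjacent v w -> ~~ adjacent u w.
Proof.
move=> uv vw; apply/negP => uw; have [_ H] := sc.
have /H/(_ erefl)/homotopic_odd // : path (@adjacent X) u [:: v; w; u].
by rewrite /= uv vw adjC uw.
Qed.

Let lift_exists := @lift_exists X npc triangle_free.
Let lift_refl := @lift_refl X npc triangle_free.
Let feq_refl := @feq_refl X npc triangle_free.

(** Distance is the length of a reduced path, which is well defined by [reduced_unique]; [dist_path]
    and [dist_le_path] identify it with the distance in the 1-skeleton. *)
Definition is_dist o n z := exists p, feq o n p p /\ head o p = z.

Lemma is_dist_exists o z : exists n, is_dist o n z.
Proof.
have [[_ con] _] := sc; have [vs vsp <-] := con o z.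
have [q L] := lift_exists (p := [:: o]) (eqv_base o) vsp.
have [_ [n qq]] := lift_refl L; exists n, q; split=> //.
exact: (lift_end L).
Qed.

Definition dist o z := projT1 (cid (is_dist_exists o z)).

Lemma distP o z : is_dist o (dist o z) z.
Proof. exact: projT2 (cid (is_dist_exists o z)). Qed.

Lemma reduced_unique_feq o n m p q : feq o n p p -> feq o m q q -> head o p = head o q ->
  n = m /\ feq o n p q.
Proof.
move=> pp qq pq.
have e : eqv o p q.
  by apply: (reduced_unique npc triangle_free sc _ _ pq); [exists n|exists m].
have pq' : feq o n p q by apply: eqv_level e; left.
split=> //; have [+ sq] := feq_size pq'; have [sq' _] := feq_size qq.
by move: sq'; rewrite sq => -[].
Qed.

Lemma is_dist_eq o n z : is_dist o n z -> n = dist o z.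
Proof.
move=> [p [pp pz]]; have [q [qq qz]] := distP o z.
by case: (reduced_unique_feq pp qq); rewrite ?pz ?qz.
Qed.

Lemma dist_path o z :
  exists vs, [/\ path (@adjacent X) o vs, size vs = dist o z & last o vs = z].
Proof.
have [p [pp pz]] := distP o z.
by have [vs [? ? + _]] := reduced_path npc triangle_free pp; rewrite pz; exists vs.
Qed.

Lemma dist_le_path o vs : path (@adjacent X) o vs -> dist o (last o vs) <= size vs.
Proof.
move=> vsp; have [q L] := lift_exists (p := [:: o]) (eqv_base o) vsp.
have [_ [n qq]] := lift_refl L.
have <- : n = dist o (last o vs).
  by apply: is_dist_eq; exists q; split=> //; exact: (lift_end L).
by have := size_path_lift L; have [-> _] := feq_size qq; rewrite /=; lia.
Qed.

Lemma dist_sym o z : dist o z = dist z o.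
Proof.
suff H a b : dist a b <= dist b a by apply/eqP; rewrite eqn_leq !H.
have [vs [vsp <- ab]] := dist_path b a; subst a.
have := @dist_le_path (last b vs) (rev (belast b vs)).
rewrite rev_path size_rev size_belast.
have -> : last (last b vs) (rev (belast b vs)) = b.
  by case: (vs) => //= v ws; rewrite rev_cons last_rcons.
apply; rewrite (eq_path (e' := @adjacent X)) // => x y; exact: adjC.
Qed.

Lemma dist0 o z : dist o z = 0 <-> z = o.
Proof.
split=> [d0|->]; last by apply/esym/is_dist_eq; exists [:: o].
have [p [pp <-]] := distP o z; rewrite d0 in pp.
by case: pp => -> _.
Qed.

Lemma dist_adj o u v : adjacent u v -> dist o v = (dist o u).+1 \/ dist o u = (dist o v).+1.
Proof.
move=> uv; have [p [pp pu]] := distP o u.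
have puv : adjacent (head o p) v by rewrite pu.
have [pv|[r rv rp]] := extP pp puv.
  left; apply/esym/is_dist_eq; exists (v :: p); split=> //; exact: feq_cons.
right; move: pp rp; case: (dist o u) => [|n] pp rp.
  by case: rp => -[po ro] _; move: puv; rewrite -rv ro /= po => /adj_neq.
congr S; apply: is_dist_eq; exists r; split=> //.
by case/feq_consP: (feq_refl rp) => // -[].
Qed.

Lemma dist_pred o n z : dist o z = n.+1 -> exists2 w, adjacent w z & dist o w = n.
Proof.
have [p [pp pz]] := distP o z => dn; move: pp; rewrite dn => /feqSP[z' [q [_ [pE _ qz _ _]]]].
have [qq adjz _] := qz; exists (head o q); first by move: adjz; rewrite -pz pE.
by apply/esym/is_dist_eq; exists q.
Qed.

(** Reduced paths to [u] and to [w], both prolonged to [z], are equivalent by uniqueness, and the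
    flip at [z] is the required square. *)
Lemma quadrangle_condition o z u w : adjacent u z -> adjacent w z -> u <> w ->
  dist o z = (dist o u).+1 -> dist o w = dist o u ->
  exists2 x, square_boundary x u z w & dist o u = (dist o x).+1.
Proof.
move=> uz wz uw dz dw; have [p [pp pu]] := distP o u; have [q [qq qw]] := distP o w.
rewrite dw in qq.
have up r v : adjacent v z -> dist o z = (dist o u).+1 -> feq o (dist o u) r r -> head o r = v ->
    extends o (feq o (dist o u)) r z.
  move=> vz _ rr rv; have [|//|[s sz sr]] := extP (z := z) rr; first by rewrite rv.
  exfalso; move: dz rr sr; case: (dist o u) => [|n] dz rr sr.
    by case: sr => -[ro so] _; move: vz; rewrite -rv ro -sz so /= => /adj_neq.
  case/feq_consP: (feq_refl sr) => // -[ss _ _] _ _.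
  have : n = dist o z by apply: is_dist_eq; exists s.
  by rewrite dz; lia.
have pz := up _ _ uz dz pp pu; have qz := up _ _ wz dz qq qw.
have [] := reduced_unique_feq (feq_cons pz) (feq_cons qz) erefl.
move=> _ /feq_consP[_ _ [/feq_end|[r [rp rq s]]]].
  by rewrite pu qw.
exists (head o r); first by move: s; rewrite pu qw.
move: pp qq rp rq s; case: (dist o u) => [|n] pp qq rp rq s.
  by case: rp rq => [[rp _] _] [[rq _] _]; move: uw; rewrite -pu -qw rp rq.
congr S; apply: is_dist_eq; exists r; split=> //.
by case/feq_consP: (feq_refl rp) => -[].
Qed.

Lemma dist_triangle u v w : dist u w <= dist u v + dist v w.
Proof.
have [vs [vsp <- vsE]] := dist_path u v; have [ws [wsp <- wsE]] := dist_path v w.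
have := @dist_le_path u (vs ++ ws); rewrite cat_path vsp vsE wsp last_cat vsE wsE size_cat.
exact.
Qed.

Lemma dist_adj1 u v : adjacent u v -> dist u v = 1.
Proof.
move=> uv; have := dist_adj u uv; have -> : dist u u = 0 by apply/dist0.
by case=> // /esym.
Qed.

(** Any two of the common neighbours span a square with [u] and [w]; two such squares through [v1]
    contradict [square_unique]. *)
Lemma no_K23 u w v1 v2 v3 : u <> w -> v1 <> v2 -> v1 <> v3 -> v2 <> v3 ->
  adjacent u v1 -> adjacent u v2 -> adjacent u v3 ->
  adjacent w v1 -> adjacent w v2 -> adjacent w v3 -> False.
Proof.
move=> uw n12 n13 n23 a1 a2 a3 b1 b2 b3.
have dw : dist u w = 2.
  have := dist_adj u b1; rewrite (dist_adj1 a1) => -[[/esym/dist0]|//].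
  by move=> wu; case: uw.
have sq a b : a <> b -> adjacent u a -> adjacent u b -> adjacent w a -> adjacent w b ->
    square_boundary u a w b.
  move=> ab ua ub wa wb; have [|||||x s dx] := @quadrangle_condition u w a b => //.
  - by rewrite adjC.
  - by rewrite adjC.
  - by rewrite (dist_adj1 ua).
  - by rewrite !dist_adj1.
  suff -> : u = x by [].
  by move: dx; rewrite (dist_adj1 ua) => -[/esym/dist0].
apply: n23; apply: (square_unique (u := u) (v := v1) (w := w)); exact: sq.
Qed.

(** * Halfspaces and medians of the graph *)

Definition halfspace u v : set X := [set x | dist x u < dist x v].

Lemma halfspaceC u v : adjacent u v -> ~` halfspace u v = halfspace v u.
Proof.
move=> uv; apply/seteqP; split=> x; rewrite /halfspace /setC /=; have := dist_adj x uv; lia.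
Qed.

Lemma halfspaceP u v x : adjacent u v ->
  (halfspace u v x /\ dist x v = (dist x u).+1) \/ (halfspace v u x /\ dist x u = (dist x v).+1).
Proof. rewrite /halfspace /= => uv; have := dist_adj x uv; lia. Qed.

(** If [x] saw the two opposite edges differently, two opposite corners would be equally near to it
    and the other two farther. The quadrangle condition then gives the near corners a third common
    neighbour, against [no_K23]. *)
Lemma halfspace_square u v w t : square_boundary u v w t -> halfspace u v = halfspace t w.
Proof.
have sub a b c d : square_boundary a b c d -> halfspace a b `<=` halfspace d c.
  move=> s; have [ab bc cd da] := square_adj s; have [_ ac bd _] := s.
  have dc : adjacent d c by rewrite adjC.
  have cb : adjacent c b by rewrite adjC.
  move=> x xab; have [[]//|[xcd dE]] := halfspaceP x dc.
  exfalso; have dab : dist x b = (dist x a).+1.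
    by have := dist_adj x ab; move: xab; rewrite /halfspace /=; lia.
  have [dac dbd] : dist x c = dist x a /\ dist x d = (dist x a).+1.
    have := dist_adj x bc; have := dist_adj x da; lia.
  have [y sy dy] := quadrangle_condition ab cb ac dab dac.
  have [ya _ _ cy] := square_adj sy.
  have yb : y <> b by move=> e; move: dy; rewrite e dab; lia.
  have yd : y <> d by move=> e; move: dy; rewrite e dbd; lia.
  by apply: (@no_K23 a c y b d); rewrite // adjC.
move=> s; apply/seteqP; split; first exact: sub.
by apply: sub; apply: square_rot; exact: square_sym.
Qed.

(** The edge from [a] to [b] slides towards the edge from [u] to [v]: the quadrangle condition, seen
    from [v], gives a square carrying it to a parallel edge starting at a neighbour of [a] nearer to
    [u]. *)
Lemma halfspace_cross u v a b : adjacent u v -> adjacent a b ->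
  halfspace u v a -> halfspace v u b -> halfspace u v = halfspace a b.
Proof.
move: {2}(dist a u) (erefl (dist a u)) => n; elim: n a b => [|n IH] a b dn uv ab ha hb.
  have ? : u = a by apply/dist0.
  subst a.
  have d0 : dist b v = 0.
    have := dist_adj v ab; have := dist_adj u uv; move: hb ha; rewrite /halfspace /=.
    rewrite (dist_sym b u) (dist_adj1 ab); lia.
  by have -> : b = v by move/dist0: d0.
have [hav hbu] : dist a v = n.+2 /\ dist b u = n.+2 /\ dist b v = n.+1.
  have := dist_adj u ab; have := dist_adj v ab; have := dist_adj a uv; have := dist_adj b uv.
  move: ha hb; rewrite /halfspace /= !(dist_sym u) !(dist_sym v); lia.
case: hbu => hbu hbv.
have [c ca dc] : exists2 c, adjacent c a & dist u c = n.
  by apply: dist_pred; rewrite dist_sym.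
have dcv : dist c v = n.+1.
  have := dist_adj v ca; have := dist_adj c uv; move: dc; rewrite !(dist_sym v) !(dist_sym u); lia.
have [|||||w sw dw] := @quadrangle_condition v a b c.
- by rewrite adjC.
- by [].
- by move=> e; move: hbu; rewrite e dist_sym dc; lia.
- by rewrite (dist_sym v a) (dist_sym v b) hav hbv.
- by rewrite (dist_sym v c) (dist_sym v b) dcv hbv.
have [wb ba ac cw] := square_adj sw.
have cu : dist c u = n by rewrite dist_sym.
have hc : halfspace u v c by rewrite /halfspace /= dcv cu.
have hw : halfspace v u w.
  have := dist_adj u wb; move: dw; rewrite /halfspace /= (dist_sym v b) hbv !(dist_sym _ w).
  by rewrite (dist_sym u b) hbu; lia.
rewrite (IH c w cu uv cw hc hw).
by apply: halfspace_square; do 3!apply: square_rot.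
Qed.

Lemma crossing_edge (h : set X) a b : h a -> ~ h b ->
  exists p q, [/\ adjacent p q, h p, ~ h q & dist a p + 1 + dist q b = dist a b].
Proof.
move: {2}(dist a b) (erefl (dist a b)) => n; elim: n b => [|n IH] b dn ha hb.
  by move/dist0: dn => e; move: hb; rewrite e.
have [c cb dc] := dist_pred dn.
have [hc|hc] := pselect (h c).
  by exists c, b; split=> //; rewrite dc (_ : dist b b = 0) ?dn; [lia|apply/dist0].
have [p [q [pq hp hq E]]] := IH c dc ha hc.
exists p, q; split=> //; apply/eqP; rewrite eqn_leq; apply/andP; split.
  by have := dist_triangle q c b; rewrite (dist_adj1 cb); lia.
have := dist_triangle a p b; have := dist_triangle p q b; rewrite (dist_adj1 pq); lia.
Qed.

(** A geodesic from [a] through [c] to [b] would leave the halfspace by an edge from [p] to [q],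
    which defines the same halfspace. But [b] is nearer to [q] than to [p]. *)
Lemma halfspace_convex u v a b c : adjacent u v -> halfspace u v a -> halfspace u v b ->
  dist a c + dist c b = dist a b -> halfspace u v c.
Proof.
move=> uv ha hb acb; apply: contrapT => hc.
have [p [q [pq hp hq E]]] := crossing_edge ha hc.
have hvq : halfspace v u q by rewrite -halfspaceC.
move: hb; rewrite (halfspace_cross uv pq hp hvq) /halfspace /= ltnNge => /negP; apply.
have := dist_triangle a p b; have := dist_triangle q c b; have := dist_triangle p q b.
by rewrite !(dist_sym b); rewrite (dist_adj1 pq); lia.
Qed.

(** Induction on the distance to [y]: a neighbour [x'] of [x] nearer to [y] is farther from [z]. It
    satisfies the hypothesis again, since the quadrangle condition turns a violation at [x'] into
    one at [x]. *)
Lemma between_of_peak x y z :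
  (forall w, adjacent x w -> ~ (dist y w < dist y x /\ dist z w < dist z x)) ->
  dist y z = dist y x + dist x z.
Proof.
move: {2}(dist y x) (erefl (dist y x)) => n; elim: n x => [|n IH] x dn nx.
  by have -> : x = y by [apply/dist0]; rewrite (_ : dist y y = 0) //; apply/dist0.
have [x' x'x dx'] := dist_pred dn; have xx' : adjacent x x' by rewrite adjC.
have dz : dist z x' = (dist z x).+1.
  have := dist_adj z xx'; have := nx x' xx'; rewrite dx' dn; lia.
rewrite (IH x' dx'); first by rewrite dx' dn (dist_sym x' z) dz (dist_sym z x); lia.
move=> w x'w [wy wz].
have wx' : adjacent w x' by rewrite adjC.
have dwz : dist z w = dist z x by have := dist_adj z x'w; lia.
have [|t st dt] := @quadrangle_condition z x' x w xx' wx' _ dz dwz.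
  by move=> xw; move: wy; rewrite -xw dx' dn; lia.
have [tx _ _ wt] := square_adj st.
apply: (nx t); first by rewrite adjC.
split; last by rewrite dt.
by have := dist_triangle y w t; rewrite (dist_adj1 wt) dn; lia.
Qed.

(** Move [x] to a neighbour nearer to both [y] and [z] as long as there is one; by [between_of_peak]
    the last position is a median. *)
Lemma median_exists x y z : exists m,
  [/\ dist x m + dist m y = dist x y, dist y m + dist m z = dist y z &
      dist x m + dist m z = dist x z].
Proof.
move: {2}(dist y x) (erefl (dist y x)) => n; elim: n x => [|n IH] x dn.
  have -> : x = y by apply/dist0.
  have dy : dist y y = 0 by apply/dist0.
  by exists y; rewrite !dy; split.
have [nx|/existsNP[w /not_implyP[xw /contrapT[wy wz]]]] := pselect (forall w, adjacent x w ->
    ~ (dist y w < dist y x /\ dist z w < dist z x)).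
  exists x; have -> : dist x x = 0 by apply/dist0.
  by rewrite (between_of_peak nx).
have [|m [m1 m2 m3]] := IH w; first by have := dist_adj y xw; lia.
exists m; split=> //.
- have := dist_triangle x w m; have := dist_triangle x m y; have := dist_adj y xw.
  by rewrite (dist_adj1 xw) !(dist_sym _ y) in m1 *; lia.
- have := dist_triangle x w m; have := dist_triangle x m z; have := dist_adj z xw.
  by rewrite (dist_adj1 xw) !(dist_sym _ z) in m3 *; lia.
Qed.

Definition halfspaces : set (set X) := [set h | exists u v, adjacent u v /\ h = halfspace u v].

Lemma sep_halfspace x y z : adjacent z y -> dist x y = (dist x z).+1 ->
  sep halfspaces x y (halfspace y z).
Proof.
move=> zy dx; split; first by exists y, z; rewrite adjC.
  by rewrite /halfspace /= dx; lia.
have yz : adjacent y z by rewrite adjC.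
by rewrite /halfspace /= (dist_adj1 yz) (_ : dist y y = 0) //; apply/dist0.
Qed.

Lemma sep_adjacent z y : adjacent z y -> sep halfspaces z y `<=` [set halfspace y z].
Proof.
move=> zy _ [[u [v [uv ->]]] hz hy] /=.
by apply: halfspace_cross => //; [rewrite adjC|rewrite -halfspaceC].
Qed.

Theorem median_walls_halfspaces : median_walls halfspaces.
Proof.
split.
- move=> _ [u [v [uv ->]]]; exists v, u; rewrite adjC; split=> //; exact: halfspaceC.
- move=> x y; move: {2}(dist x y) (erefl (dist x y)) => n; elim: n y => [|n IH] y dn.
    have -> : y = x by apply/dist0.
    by rewrite sepxx; exact: finite_set0.
  have [z zy dz] := dist_pred dn.
  apply: sub_finite_set (@sep_triangle _ halfspaces z x y) _.
  rewrite finite_setU; split; first exact: IH.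
  exact: sub_finite_set (sep_adjacent zy) (finite_set1 _).
- move=> x y xy; apply: contrapT => ne.
  have [n dn] : exists n, dist x y = n.+1.
    case: (dist x y) (@dist0 x y) => [[/(_ erefl) yx]|n _]; last by exists n.
    by case: ne.
  have [z zy dz] := dist_pred dn.
  by have := sep_halfspace (x := x) zy; rewrite dz dn xy => /(_ erefl).
- move=> x y z; have [m [m1 m2 m3]] := median_exists x y z.
  exists m => _ [u [v [uv ->]]] [[hx hy]|[[hx hy]|[hx hy]]].
  + exact: halfspace_convex m1.
  + exact: halfspace_convex m2.
  + exact: halfspace_convex m3.
Qed.

(** Let [z] precede [y] on a geodesic. By convexity a halfspace between [x] and [z] also separates
    [x] from [y], so it is [halfspace y z], which does not contain [z]; hence [x = z]. *)
Lemma adjacent_nb_sep x y : nb (sep halfspaces x y) = 1 -> adjacent x y.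
Proof.
move=> /(nb_eq1 (finite_sep median_walls_halfspaces x y)) [h xyh].
have [n dn] : exists n, dist x y = n.+1.
  case: (dist x y) (@dist0 x y) => [[/(_ erefl) yx]|n _]; last by exists n.
  have : sep halfspaces x y h by rewrite xyh.
  by rewrite yx sepxx.
have [z zy dz] := dist_pred dn.
have [xz|xz] := pselect (x = z); first by rewrite xz.
have hE : halfspace y z = h.
  suff : sep halfspaces x y (halfspace y z) by rewrite xyh.
  by apply: sep_halfspace => //; rewrite dz.
exfalso; apply: xz; apply: (sep_eq0 median_walls_halfspaces).
apply/seteqP; split=> // k [Wk kx kz].
have ky : k y.
  apply: contrapT => ky; have [u [v [uv kE]]] := Wk; move: kx ky kz; rewrite kE => kx ky kz.
  suff : (~` halfspace u v) z by [].
  rewrite halfspaceC //; apply: (halfspace_convex (a := x) (b := y)).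
  - by rewrite adjC.
  - by rewrite -halfspaceC.
  - by rewrite -halfspaceC.
  - by rewrite dz dn (dist_adj1 zy); lia.
have kh : k = h by suff : sep halfspaces x y k by rewrite xyh.
move: kz; rewrite kh -hE /halfspace /= (_ : dist z z = 0) //; exact/dist0.
Qed.

Lemma automorphism_adjacent (f : X -> X) u v :
  cubical_automorphism f -> adjacent (f u) (f v) = adjacent u v.
Proof.
move=> [fb fcube]; have finj := bij_inj fb.
have E : [set f u; f v] = f @` [set u; v].
  by rewrite image_setU !image_set1.
apply/idP/idP => /adjP[ne c]; apply/adjP; split.
- by move=> uv; apply: ne; rewrite uv.
- by apply: (fcube _).2; rewrite -E.
- by move/finj.
- by rewrite E; apply: (fcube _).1.
Qed.

Lemma automorphism_dist (f : X -> X) u v : cubical_automorphism f -> dist (f u) (f v) = dist u v.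
Proof.
move=> af; have [[g fK gK] fcube] := af.
have ag : cubical_automorphism g.
  split; first by exists f.
  move=> c; have fg : f @` (g @` c) = c.
    by rewrite image_comp (_ : f \o g = id) ?image_id //; apply/funext => x /=.
  by have := fcube (g @` c); rewrite fg; tauto.
have le (h : X -> X) a b : cubical_automorphism h -> dist (h a) (h b) <= dist a b.
  move=> ah; have [vs [vsp <- <-]] := dist_path a b.
  have := @dist_le_path (h a) (map h vs); rewrite size_map last_map; apply.
  by rewrite path_map (eq_path (e' := @adjacent X)) // => x y /=; exact: automorphism_adjacent.
by apply/eqP; rewrite eqn_leq le // -{1}(fK u) -{1}(fK v) le.
Qed.

Lemma automorphism_walls (f : X -> X) : cubical_automorphism f -> wall_automorphism halfspaces f.
Proof.
move=> af; have [[g fK gK] _] := af; split; first by exists g.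
move=> h; split=> -[u [v [uv hE]]].
  exists (g u), (g v); rewrite -(automorphism_adjacent _ _ af) !gK; split=> //.
  rewrite hE; apply/seteqP; split=> x; rewrite /halfspace /preimage /=.
    by rewrite -(automorphism_dist x (g u) af) -(automorphism_dist x (g v) af) !gK.
  by rewrite -(automorphism_dist x (g u) af) -(automorphism_dist x (g v) af) !gK.
exists (f u), (f v); rewrite automorphism_adjacent //; split=> //.
have E x : h x = (f @^-1` h) (g x) by rewrite /preimage /= gK.
apply/seteqP; split=> x; rewrite E hE /halfspace /=.
  by rewrite -(automorphism_dist (g x) u af) -(automorphism_dist (g x) v af) !gK.
by rewrite -(automorphism_dist (g x) u af) -(automorphism_dist (g x) v af) !gK.
Qed.

End Distance.

(** * The cube complex of a discrete median algebra *)

Section WallComplex.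
Variables (V : Type) (W : set (set V)).
Hypothesis mw : median_walls W.
Local Notation sep := (sep W).
Let finite_sep := finite_sep mw.
Let wallC := wallC mw.

Definition avoids (I : Type) (h : I -> set V) (k : set V) :=
  forall i, k <> h i /\ k <> ~` h i.

(* [f] parametrises a cube whose hyperplanes bound the halfspaces [h i]. *)
Definition spans (I : finType) (h : I -> set V) (f : {ffun I -> bool} -> V) :=
  [/\ forall i, W (h i), forall e i, h i (f e) <-> e i &
      forall k, W k -> avoids h k -> forall e e', k (f e) -> k (f e')].

(** An arbitrary finite index type makes faces easy: the face with coordinates prescribed outside
    [J] is indexed by [J]. *)
Definition wall_cube (c : set V) :=
  exists (I : finType) (h : I -> set V) (f : {ffun I -> bool} -> V),
    spans h f /\ range f = c.

Lemma avoidsP (I : finType) (h : I -> set V) k :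
  avoids h k \/ exists i, k = h i \/ k = ~` h i.
Proof.
have [H|H] := pselect (avoids h k); [by left|right].
have [i /not_andP[/contrapT|/contrapT] ki] : exists i, ~ (k <> h i /\ k <> ~` h i).
- exact/existsNP.
- by exists i; left.
- by exists i; right.
Qed.

Lemma avoidsC (I : finType) (h : I -> set V) k : avoids h k -> avoids h (~` k).
Proof.
move=> H i; have [H1 H2] := H i; split=> e.
  by apply: H2; rewrite -e setCK.
by apply: H1; rewrite -(setCK k) e setCK.
Qed.

Lemma spans_point (I : finType) (h : I -> set V) f e x : spans h f ->
  (forall k, W k -> avoids h k -> k (f e) -> k x) -> x = f [ffun i => `[< h i x >]].
Proof.
move=> [Wh hf const] kx; apply: (eq_walls mw) => k Wk.
set e' := [ffun _ => _]; have E i : h i (f e') <-> h i x.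
  by rewrite hf ffunE; split => /asboolP.
have [av|[i [->|->]]] := avoidsP h k.
- by move=> ke'; apply: kx => //; exact: const ke'.
- by move/E.
- by move=> nh hx; apply: nh; apply/E.
Qed.

Lemma spans_inj (I : finType) (h : I -> set V) f : spans h f -> injective f.
Proof.
move=> [_ hf _] e e' ee'; apply/ffunP => i.
by apply/idP/idP => ei; apply/hf; [rewrite -ee'|rewrite ee']; apply/hf.
Qed.

Lemma wall_cube_ord c : wall_cube c ->
  exists n (h : 'I_n -> set V) (f : {ffun 'I_n -> bool} -> V), spans h f /\ range f = c.
Proof.
move=> [I [h [f [[Wh hf const] fc]]]].
exists #|I|, (h \o enum_val), (fun e => f [ffun i => e (enum_rank i)]); split.
  split=> [i|e i|k Wk av e e']; first exact: Wh.
    by rewrite /= hf ffunE enum_valK.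
  apply: const => // i; have := av (enum_rank i); by rewrite /= enum_rankK.
rewrite -fc; apply/seteqP; split=> [_ [e _ <-]|_ [e _ <-]]; first by eexists.
exists [ffun j => e (enum_val j)] => //; congr f; apply/ffunP => i.
by rewrite !ffunE enum_rankK.
Qed.

Lemma wall_cube_subcube (I : finType) (h : I -> set V) f (e0 : {ffun I -> bool}) (J : {set I}) :
  spans h f -> wall_cube (f @` [set e : {ffun I -> bool} | forall i, i \notin J -> e i = e0 i]).
Proof.
move=> [Wh hf const].
pose ext (e : {ffun {i | i \in J} -> bool}) : {ffun I -> bool} :=
  [ffun i => if insub i is Some j then e j else e0 i].
have extJ e j : ext e (val j) = e j by rewrite ffunE valK.
have extN e i : i \notin J -> ext e i = e0 i by move=> iJ; rewrite ffunE insubN.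
exists {i | i \in J}, (h \o val), (f \o ext); split.
  split=> [i|e i|k Wk av e e']; [exact: Wh|by rewrite /= hf extJ|].
  have [avh|[i kE]] := avoidsP h k; first exact: const.
  have iJ : i \notin J.
    apply/negP => iJ; have [] := av (exist _ i iJ); case: kE => -> /=; tauto.
  by case: kE => -> /=; rewrite ?/setC /= !hf !extN.
apply/seteqP; split=> [_ [e _ <-]|_ [e eJ <-]] /=.
  by exists (ext e) => // i iJ; exact: extN.
exists [ffun j => e (val j)] => //=; congr f; apply/ffunP => i; rewrite ffunE.
case: insubP => [j _ <-|/eJ //]; by rewrite ffunE.
Qed.

Lemma wall_cube1 v : wall_cube [set v].
Proof.
exists 'I_0, (fun=> setT), (fun=> v); split; first by split=> [[]//|e []|].
by apply/seteqP; split=> [_ [e _ <-]//|_ ->]; exists [ffun=> true].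
Qed.

Lemma wall_cubeP c : wall_cube c ->
  exists n (f : {ffun 'I_n -> bool} -> V), [/\ injective f, range f = c &
    forall a, a `<=` c -> (wall_cube a <-> exists s, a = f @` cube_face s)].
Proof.
move=> /wall_cube_ord[n [h [f [sp fc]]]]; exists n, f; split=> //; first exact: spans_inj sp.
have [Wh hf const] := sp.
move=> a ac; split=> [[I [h' [f' [sp' fa]]]]|[s ->]]; last first.
  have := wall_cube_subcube [ffun i => odflt false (s i)] [set i | s i == None] sp.
  congr wall_cube; congr image; apply/seteqP; split=> e es i.
    move=> b sb; have := es i; rewrite inE sb ffunE sb; exact.
  rewrite inE ffunE; move: (es i); case: (s i) => [b /(_ b erefl) //|//].
have [Wh' hf' const'] := sp'; pose e0 : {ffun I -> bool} := [ffun=> true].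
have af' e : a (f' e) by rewrite -fa; exists e.
(* A coordinate is prescribed exactly when [a] lies on one side of the corresponding hyperplane. *)
pose s := [ffun i => if `[< a `<=` h i >] then Some true else
                     if `[< a `<=` ~` h i >] then Some false else None].
have st i : a `<=` h i -> s i = Some true by move=> ai; rewrite ffunE asboolT.
have sf i : a `<=` ~` h i -> s i = Some false.
  move=> ai; rewrite ffunE asboolF ?asboolT // => ai'.
  exact: ai (af' e0) (ai' _ (af' e0)).
exists s; apply/seteqP; split=> [x ax|_ [e es <-]].
  have [e _ xE] : range f x by rewrite fc; exact: ac.
  exists e => // i b; rewrite ffunE.
  case: asboolP => [ai [<-]|_]; first by apply/hf; rewrite xE; exact: ai.
  case: asboolP => [ai [<-]|//]; apply/negP => /hf; rewrite xE; exact: ai.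
suff -> : f e = f' [ffun j => `[< h' j (f e) >]] by [].
(* A halfspace not bounded by a hyperplane of [a] is constant on [a]. Either it is constant on [c]
   too, or its side is prescribed by [s]. *)
apply: (spans_point (e := e0) sp') => // k Wk avk ke0.
have aP x : a x -> k x.
  by rewrite -fa => -[e' _ <-]; exact: const' ke0.
have [av|[i [kE|kE]]] := avoidsP h k.
- have [e1 _ e1E] : range f (f' e0) by rewrite fc; exact: ac.
  by apply: (const k Wk av e1); rewrite e1E.
- by rewrite kE; apply/hf/es/st; rewrite -kE.
- rewrite kE => /hf; rewrite (es i false) //; apply: sf; by rewrite -kE.
Qed.

Lemma wall_cubeI c d : wall_cube c -> wall_cube d -> c `&` d !=set0 -> wall_cube (c `&` d).
Proof.
move=> [I [h [f [sp fc]]]] [J [k [g [sq gd]]]] [x0 [cx0 dx0]].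
have [Wh hf hconst] := sp; have [Wk kg kconst] := sq.
have [e0 _ e0E] : range f x0 by rewrite fc.
have [d0 _ d0E] : range g x0 by rewrite gd.
(* The intersection is the face of [c] through [x0] in the directions of the hyperplanes common to
   both cubes. *)
have := wall_cube_subcube e0 [set i | ~~ `[< avoids k (h i) >]] sp.
congr wall_cube; apply/seteqP; split=> [_ [e eK <-]|x [cx dx]].
  split; first by rewrite -fc; exists e.
  suff -> : f e = g [ffun j => `[< k j (f e) >]] by rewrite -gd; eexists.
  apply: (spans_point (e := d0) sq) => // w Ww avw; rewrite d0E -e0E.
  have [avh|[i wE]] := avoidsP h w; first exact: hconst.
  have ei : e i = e0 i.
    apply: eK; rewrite inE negbK; apply/asboolP.
    case: wE => wE; first by rewrite -wE.
    by rewrite -(setCK (h i)) -wE; exact: avoidsC.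
  by case: wE => ->; rewrite ?/setC /= !hf ei.
have [e _ eE] : range f x by rewrite fc.
have [d1 _ d1E] : range g x by rewrite gd.
exists e => // i; rewrite inE negbK => /asboolP av.
have eq y y' : d y -> d y' -> h i y -> h i y'.
  by rewrite -gd => -[? _ <-] [? _ <-]; exact: kconst.
by apply/idP/idP => /hf; rewrite ?eE ?e0E => hi; apply/hf; rewrite ?eE ?e0E; exact: eq hi.
Qed.

Definition wall_complex : cube_complex := CubeComplex wall_cube1 wall_cubeP wall_cubeI.
Local Notation adj := (@adjacent wall_complex).

Lemma sep_inj v x y : sep v x = sep v y -> x = y.
Proof.
move=> xy; apply: (eq_walls mw) => k Wk ky; apply: contrapT => kx.
have [kv|kv] := pselect (k v).
  have : sep v x (~` k) by split=> //; exact: wallC.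
  by rewrite xy => -[].
by have : sep v y k by []; rewrite -xy => -[].
Qed.

Lemma spans_corner (I : finType) (h : I -> set V) (f : {ffun I -> bool} -> V) v :
  injective h -> (forall i, W (h i)) -> (forall i, ~ h i v) ->
  (forall e, sep v (f e) = [set k | exists2 i, e i & k = h i]) -> spans h f.
Proof.
move=> hinj Wh hv fE; split=> // [e i|k Wk av].
  split=> [hi|ei].
    have : sep v (f e) (h i) by [].
    by rewrite fE => -[j ej /hinj ->].
  by have [] : sep v (f e) (h i) by rewrite fE; exists i.
have kv e : k (f e) <-> k v.
  split=> H; apply: contrapT => H'.
    have : sep v (f e) k by [].
    by rewrite fE => -[i _ /(av i).1].
  have : sep v (f e) (~` k) by split=> //; exact: wallC.
  by rewrite fE => -[i _ ki]; apply: (av i).2; rewrite -ki setCK.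
by move=> e e' /kv ?; apply/kv.
Qed.

Lemma spans_sep (I : finType) (h : I -> set V) f e e' k : spans h f ->
  sep (f e) (f e') k <-> exists i, e i != e' i /\ k = if e' i then h i else ~` h i.
Proof.
move=> [Wh hf const]; split=> [[Wk ke ke']|[i [ei ->]]].
  have [av|[i kE]] := avoidsP h k; first by case: ke; exact: const ke'.
  exists i; case: kE => kE; move: ke ke'; rewrite kE ?/setC /= !hf; case: (e i); case: (e' i) => // H H'; case: H.
move: ei; case E : (e i); case E' : (e' i) => // _; split.
- exact: wallC.
- by apply; apply/hf.
- by move/hf; rewrite E'.
- exact: Wh.
- by move/hf; rewrite E.
- exact/hf.
Qed.

Lemma ffun_flip_sep n (h : 'I_n -> set V) f e i : spans h f ->
  sep (f e) (f (flip i e)) = [set if e i then ~` h i else h i].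
Proof.
move=> sp; apply/seteqP; split=> k; rewrite (spans_sep _ _ _ sp).
  move=> [j]; rewrite ffunE; have [->|_] := eqVneq j i; last by rewrite eqxx => -[].
  by case: (e i) => -[_ ->].
move=> ->; exists i; rewrite ffunE eqxx; by case: (e i).
Qed.

Lemma wall_cube2 u v k : sep u v = [set k] -> wall_cube [set u; v].
Proof.
move=> uvk; have [Wk ku kv] : sep u v k by rewrite uvk.
exists 'I_1, (fun=> k), (fun e : {ffun 'I_1 -> bool} => if e ord0 then v else u); split.
  apply: (spans_corner (v := u)) => //; first by move=> i j _; rewrite !ord1.
  move=> e; case: ifP => e0; rewrite ?sepxx ?uvk; apply/seteqP; split=> l //=.
  - by move=> ->; exists ord0.
  - by case=> i _ ->.
  - by case=> i; rewrite ord1 e0.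
apply/seteqP; split=> [_ [e _ <-]|x [->|->]].
- by case: ifP; [right|left].
- by exists [ffun=> false] => //; rewrite ffunE.
- by exists [ffun=> true] => //; rewrite ffunE.
Qed.

Lemma wall_adjacent u v : adj u v <-> exists k, sep u v = [set k].
Proof.
rewrite adjP; split=> [[uv /wall_cube_ord[n [h [f [sp fE]]]]]|[k uvk]]; last first.
  split; last exact: wall_cube2 uvk.
  move=> uv; have : sep u v k by rewrite uvk.
  by rewrite uv sepxx.
have [eu _ euE] : range f u by rewrite fE; left.
have [ev _ evE] : range f v by rewrite fE; right.
have /existsP[i ei] : [exists i, eu i != ev i].
  apply: contrapT => /negP; rewrite negb_exists => /forallP H; apply: uv.
  by rewrite -euE -evE; congr f; apply/ffunP => i; apply/eqP; move: (H i); rewrite negbK.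
have : range f (f (flip i eu)) by exists (flip i eu).
rewrite fE -euE -evE => -[/(spans_inj sp)/flip_neq//|/(spans_inj sp) <-].
by rewrite (ffun_flip_sep eu i sp); eexists.
Qed.

Lemma wall_adjacent_nb u v : adj u v <-> nb (sep u v) = 1.
Proof.
rewrite wall_adjacent; split=> [[k ->]|]; first exact: nb_set1.
exact: nb_eq1.
Qed.

Lemma wall_square u v w t a b : a <> b -> sep u v = [set a] -> sep u t = [set b] ->
  sep u w = [set a; b] -> @square_boundary wall_complex u v w t.
Proof.
move=> ab uv ut uw.
have [Wa au av] : sep u v a by rewrite uv.
have [Wb bu bt] : sep u t b by rewrite ut.
pose h (i : 'I_2) := if i == ord0 then a else b.
pose f (e : {ffun 'I_2 -> bool}) :=
  if e ord0 then if e ord_max then w else v else if e ord_max then t else u.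
have o2 (i : 'I_2) : i = ord0 \/ i = ord_max.
  by case: i => -[|[|//]] ?; [left|right]; apply: val_inj.
have sp : spans h f.
  apply: (spans_corner (v := u)).
  - by move=> i j; rewrite /h; case: (o2 i) (o2 j) => -> [] -> //= e; case: ab.
  - by move=> i; rewrite /h; case: ifP.
  - by move=> i; rewrite /h; case: ifP.
  - move=> e; rewrite /f; case e0 : (e ord0); case e1 : (e ord_max);
    rewrite ?uv ?ut ?uw ?sepxx; apply/seteqP; split=> k /=.
    + by case=> ->; [exists ord0|exists ord_max].
    + by case=> i _ ->; rewrite /h; case: ifP; [left|right].
    + by move=> ->; exists ord0.
    + by case=> i; case: (o2 i) => ->; rewrite ?e1.
    + by move=> ->; exists ord_max.
    + by case=> i; case: (o2 i) => ->; rewrite ?e0.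
    + by [].
    + by case=> i; case: (o2 i) => ->; rewrite ?e0 ?e1.
pose E b0 b1 : {ffun 'I_2 -> bool} := [ffun i => if i == ord0 then b0 else b1].
have fE b0 b1 : f (E b0 b1) = if b0 then if b1 then w else v else if b1 then t else u.
  by rewrite /f /E !ffunE.
have adjE b0 b1 b0' b1' : (b0 == b0') (+) (b1 == b1') -> adj (f (E b0 b1)) (f (E b0' b1')).
  move=> H; apply/wall_adjacent.
  have [i iE] : exists i, E b0' b1' = flip i (E b0 b1).
    move: H; have [<-|n0] := eqVneq b0 b0'; have [<-|n1] := eqVneq b1 b1' => // _.
      by exists ord_max; apply/ffunP => j; rewrite !ffunE; case: (o2 j) => -> //=;
         move: n1; case: (b1); case: (b1').
    by exists ord0; apply/ffunP => j; rewrite !ffunE; case: (o2 j) => -> //=;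
       move: n0; case: (b0); case: (b0').
  by rewrite iE (ffun_flip_sep _ _ sp); eexists.
split.
- exists 'I_2, h, f; split=> //; apply/seteqP; split=> [_ [e _ <-]|x].
    by rewrite /f; case: (e ord0); case: (e ord_max); [right; left|left; right|right; right|left; left].
  case=> -[] ->; [exists (E false false)|exists (E true false)|exists (E true true)|exists (E false true)];
    by rewrite ?fE.
- by move=> uw'; move: uw; rewrite -uw' sepxx => /seteqP[_ /(_ a)]; apply; left.
- by move=> vt; move: ut; rewrite -vt uv => /seteqP[/(_ a erefl)].
- have := adjE false false true false isT; have := adjE true false true true isT.
  have := adjE true true false true isT; have := adjE false true false false isT.
  by rewrite !fE /= => -> -> -> ->.
Qed.

Lemma sep1C u v k : sep u v = [set k] -> sep v u = [set ~` k].
Proof.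
move=> uv; apply/seteqP; split=> [l /(sep_setC mw)|_ ->].
  by rewrite uv => /= <-; rewrite setCK.
by apply: (sep_setC mw); rewrite uv.
Qed.

Lemma sep1_iff u v k l : sep u v = [set k] -> W l -> l <> k -> l <> ~` k -> (l u <-> l v).
Proof.
move=> uv Wl lk lk'; split=> H; apply: contrapT => H'.
  have : sep v u l by [].
  by rewrite (sep1C uv).
have : sep u v l by [].
by rewrite uv.
Qed.

Lemma nb_sep_adjacent v a w k : sep a w = [set k] -> ~ k v ->
  nb (sep v w) = (nb (sep v a)).+1.
Proof.
move=> aw kv; have [Wk ka kw] : sep a w k by rewrite aw.
rewrite -(@nb_setU1 _ (sep v a) k) //; last by case.
congr nb; apply/seteqP; split=> [l [Wl lv lw]|l [->//|[Wl lv la]]].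
  have [la|la] := pselect (l a); first by right.
  by left; have : sep a w l by []; rewrite aw.
split=> //; apply: contrapT => lw.
have : sep w a l by [].
by rewrite (sep1C aw) => /= lE; apply: lv; rewrite lE.
Qed.

(** The fourth corner is [med v a b]: [a] and [b] differ by [ka] and [kb] alone, up to complement,
    and there [v] decides. *)
Lemma wall_diamond v a b w ka kb : a <> b -> sep a w = [set ka] -> sep b w = [set kb] ->
  ~ ka v -> ~ kb v -> exists x, [/\ @square_boundary wall_complex x a w b &
    nb (sep v a) = (nb (sep v x)).+1].
Proof.
move=> ab aw bw kav kbv.
have [Wka kaa kaw] : sep a w ka by rewrite aw.
have [Wkb kbb kbw] : sep b w kb by rewrite bw.
have kab : kb <> ka.
  by move=> e; apply: ab; apply: (@sep_inj w); rewrite (sep1C aw) (sep1C bw) e.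
have kab' : kb <> ~` ka by move=> e; apply: kbv; rewrite e.
have kba' : ka <> ~` kb by move=> e; apply: kav; rewrite e.
have kba : kb a by apply/(sep1_iff aw Wkb kab kab').
have kab2 : ka b by apply/(sep1_iff bw Wka _ kba') => // e; exact: kab.
have mi k := med_iff mw v a b (h := k).
set x := med mw v a b in mi.
have xa : sep x a = [set kb].
  apply/seteqP; split=> [k [Wk + ka']|_ ->]; last first.
    by split=> //; move/(mi _ Wkb); tauto.
  rewrite mi // => kx; have kw : k w.
    apply/(sep1_iff aw Wk) => // e; first by apply: kaa; rewrite -e.
    by apply: kx; left; split=> //; rewrite e.
  have : sep b w k by split=> //; tauto.
  by rewrite bw.
have xb : sep x b = [set ka].
  apply/seteqP; split=> [k [Wk + kb']|_ ->]; last first.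
    by split=> //; move/(mi _ Wka); tauto.
  rewrite mi // => kx; have kw : k w.
    apply/(sep1_iff bw Wk) => // e; first by apply: kbb; rewrite -e.
    by apply: kx; right; right; split=> //; rewrite e.
  have : sep a w k by split=> //; tauto.
  by rewrite aw.
have [_ kbx _] : sep x a kb by rewrite xa.
have [_ kax _] : sep x b ka by rewrite xb.
exists x; split; last exact: nb_sep_adjacent xa kbv.
apply: (wall_square kab xa xb); apply/seteqP; split=> [k [Wk kx kw]|k [] ->//].
have [ka'|ka'] := pselect (k a).
  by left; have : sep x a k by []; rewrite xa.
by right; have : sep a w k by []; rewrite aw.
Qed.

(** * Simple connectivity of the wall complex *)

Local Notation hom := (@homotopic wall_complex).

Lemma homotopic_cat (S S' B : seq V) : hom S S' -> hom (S ++ B) (S' ++ B).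
Proof.
elim=> [{}S {}S' e|{}S|{}S {}S' _|S1 S2 S3 _ + _].
- apply: rst_step; case: e => [p q u v uv|p q u v w t s]; rewrite -!catA.
    exact: (homotopy_backtrack p (q ++ B) uv).
  exact: (homotopy_square p (q ++ B) s).
- exact: rst_refl.
- exact: rst_sym.
- exact: rst_trans.
Qed.

Lemma homotopic_flip (A : seq V) u v w t : @square_boundary wall_complex u v w t ->
  hom (A ++ [:: u; v; w]) (A ++ [:: u; t; w]).
Proof.
move=> s; have [_ _ wt tu] := square_adj s.
apply: (@rst_trans _ _ _ (A ++ [:: u; v; w; t; w])).
  apply: rst_sym; apply: rst_step.
  have := @homotopy_backtrack wall_complex (A ++ [:: u; v]) [::] w t wt.
  by rewrite -!catA.
apply: (@rst_trans _ _ _ (A ++ [:: u; v; w; t; u; t; w])).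
  apply: rst_sym; apply: rst_step.
  have := @homotopy_backtrack wall_complex (A ++ [:: u; v; w]) [:: w] t u tu.
  by rewrite -!catA.
apply: rst_step; exact: (@homotopy_square wall_complex A [:: t; w] _ _ _ _ s).
Qed.

Lemma nb_sep_path v p : path adj v p -> nb (sep v (last v p)) <= size p.
Proof.
elim/last_ind: p => [|p w IH] /=; first by rewrite sepxx nb0.
rewrite rcons_path last_rcons size_rcons => /andP[/IH le /wall_adjacent_nb one].
by apply: leq_trans (nb_sep_triangle mw (last v p) v w) _; rewrite one addn1 ltnS.
Qed.

Lemma geodesic_exists v w : exists p, [/\ path adj v p, last v p = w & size p = nb (sep v w)].
Proof.
move: {2}(nb (sep v w)) (erefl (nb (sep v w))) => n; elim: n w => [|n IH] w dn.
  by exists [::]; rewrite dn (nb_sep_eq0 mw dn).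
have [h wvh] : sep w v !=set0.
  apply: contrapT => /set0P/negP/negPn/eqP e; move: dn.
  by rewrite nb_sepC // e nb0.
have [k wvk [_ kmax]] := exists_maximal (finite_sep w v) wvh.
have [y wy] := sep_maximal_adjacent mw wvk kmax.
have yw := sep1C wy.
have dw : nb (sep v w) = (nb (sep v y)).+1.
  by apply: nb_sep_adjacent yw _; case: wvk => _ _ kv /(_ kv).
have [|p [pp py ps]] := IH y; first by move: dw; rewrite dn => -[].
exists (rcons p w); rewrite rcons_path last_rcons size_rcons pp py ps dw; split=> //.
by apply/wall_adjacent; eexists; exact: yw.
Qed.

(** If the last edges come from different vertices, [wall_diamond] gives a square with a corner [x]
    nearer to [v]. A geodesic through [x] can then be compared with both paths by induction and
    flipped across the square. *)
Lemma geodesics_homotopic v n w p q : nb (sep v w) = n ->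
  path adj v p -> size p = n -> last v p = w ->
  path adj v q -> size q = n -> last v q = w -> hom (v :: p) (v :: q).
Proof.
elim: n w p q => [|n IH] w p q dn.
  by move=> _ /size0nil -> _ _ /size0nil -> _; exact: rst_refl.
case/lastP: p => [//|p w']; case/lastP: q => [//|q w''].
rewrite !rcons_path !last_rcons !size_rcons => /andP[pp aw] [ps] w'E.
move=> /andP[qp bw] [qs] w''E; subst w' w''; rewrite -!rcons_cons -!cats1.
have dist_le r : path adj v r -> size r = n -> adj (last v r) w ->
    nb (sep v (last v r)) = n /\ exists2 k, sep (last v r) w = [set k] & ~ k v.
  move=> rp rs rw; have le := nb_sep_path rp; have /wall_adjacent[k kE] := rw.
  have kv : ~ k v.
    move=> kv; have : ~ (~` k) v by [].
    by move/(nb_sep_adjacent (sep1C kE)); rewrite dn => e; move: le; rewrite rs [X in X <= _]e; lia.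
  by split; [move: (nb_sep_adjacent kE kv); rewrite dn => -[]|exists k].
have [da [ka kaE kav]] := dist_le p pp ps aw; have [db [kb kbE kbv]] := dist_le q qp qs bw.
have [ab|ab] := pselect (last v p = last v q).
  by apply: homotopic_cat; apply: (IH (last v p)).
have [x [sx dx]] := wall_diamond ab kaE kbE kav kbv.
have [r [rp rx rs]] := geodesic_exists v x.
have [xa _ _ bx] := square_adj sx.
have rE e : adj x e -> path adj v (rcons r e) /\ last v (rcons r e) = e.
  by rewrite rcons_path last_rcons rp rx.
have rs' e : size (rcons r e) = n by rewrite size_rcons rs -dx.
apply: (@rst_trans _ _ _ ((v :: rcons r (last v p)) ++ [:: w])).
  by apply: homotopic_cat; apply: (IH (last v p)) => //; case: (rE _ xa).
apply: (@rst_trans _ _ _ ((v :: rcons r (last v q)) ++ [:: w])); last first.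
  apply: homotopic_cat; apply: (IH (last v q)) => //; rewrite adjC in bx; by case: (rE _ bx).
rewrite -!rcons_cons !cats1 !(lastI v r) rx -!cats1 -!catA /=.
exact: homotopic_flip.
Qed.

Lemma path_homotopic_geodesic v p : path adj v p -> forall q, path adj v q ->
  last v q = last v p -> size q = nb (sep v (last v p)) -> hom (v :: p) (v :: q).
Proof.
elim/last_ind: p => [|p w IH] /=.
  by move=> _ q _ _; rewrite sepxx nb0 => /size0nil ->; exact: rst_refl.
rewrite rcons_path last_rcons => /andP[pp aw] q qp qw qs.
have [g [gp ga gs]] := geodesic_exists v (last v p).
have pg := IH pp g gp ga gs.
rewrite -rcons_cons -cats1; apply: (@rst_trans _ _ _ ((v :: g) ++ [:: w])).
  exact: homotopic_cat.
have /wall_adjacent[k kE] := aw.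
have [kv|kv] := pselect (k v); last first.
  rewrite cat_cons cats1; apply: (geodesics_homotopic (w := w) (erefl _)) => //.
  - by rewrite rcons_path gp ga.
  - by rewrite size_rcons gs (nb_sep_adjacent kE).
  - by rewrite last_rcons.
(* Here the last edge leads back towards [v], so the geodesic to its origin may be chosen through
   [w], and a backtrack remains. *)
have kv' : ~ (~` k) v by [].
have dE := nb_sep_adjacent (sep1C kE) kv'.
apply: (@rst_trans _ _ _ ((v :: rcons q (last v p)) ++ [:: w])).
  apply: homotopic_cat; apply: (geodesics_homotopic (w := last v p) (erefl _)) => //.
  - by rewrite rcons_path qp qw adjC.
  - by rewrite size_rcons qs dE.
  - by rewrite last_rcons.
rewrite -rcons_cons lastI qw -!cats1 -!catA /=; apply: rst_step.
have := @homotopy_backtrack wall_complex (belast v q) [::] w (last v p).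
by rewrite adjC; exact.
Qed.

Lemma wall_complex_connected : (exists v : V, True) -> connected_complex wall_complex.
Proof.
move=> v0; split=> // u v; have [p [pp pv _]] := geodesic_exists u v; by exists p.
Qed.

Lemma wall_complex_simply_connected :
  (exists v : V, True) -> simply_connected wall_complex.
Proof.
move=> v0; split; first exact: wall_complex_connected.
move=> v p pp pv; apply: (path_homotopic_geodesic pp) => //.
by rewrite pv sepxx nb0.
Qed.

(** * Flag condition for the links *)

Lemma link_corner v x y a b : x <> y -> sep v x = [set a] -> sep v y = [set b] ->
  @link wall_complex v [set x; y] -> exists q, sep v q = [set a; b].
Proof.
move=> xy vx vy [c cubc [cv xyE]].
have [n [h [f [sp fc]]]] := wall_cube_ord cubc.
have [cx cy] : c x /\ c y.
  have [[cx _] [cy _]] : [set u | c u /\ adj v u] x /\ [set u | c u /\ adj v u] y.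
    by rewrite -xyE; split; [left|right].
  by [].
have [e _ eE] : range f v by rewrite fc.
have neigh z k : c z -> sep v z = [set k] -> exists i, z = f (flip i e).
  rewrite -fc => -[ez _ <-]; rewrite -eE => ek.
  have [i [ei _]] : exists i, e i != ez i /\ k = if ez i then h i else ~` h i.
    by apply/(spans_sep _ _ _ sp); rewrite ek.
  exists i; apply: (@sep_inj (f e)); rewrite ek (ffun_flip_sep _ _ sp).
  have : sep (f e) (f ez) (if ez i then h i else ~` h i).
    by apply/(spans_sep _ _ _ sp); exists i.
  by rewrite ek => /= <-; congr [set _]; move: ei; case: (e i); case: (ez i).
have [i xE] := neigh x a cx vx; have [j yE] := neigh y b cy vy.
have ij : i <> j by move=> ij; apply: xy; rewrite xE yE ij.
have aE : a = if e i then ~` h i else h i.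
  by have := ffun_flip_sep e i sp; rewrite eE -xE vx => /seteqP[/(_ a erefl)].
have bE : b = if e j then ~` h j else h j.
  by have := ffun_flip_sep e j sp; rewrite eE -yE vy => /seteqP[/(_ b erefl)].
have ji : (i == j) = false by apply/eqP.
exists (f (flip i (flip j e))); rewrite -eE.
apply/seteqP; split=> k; rewrite (spans_sep _ _ _ sp).
  move=> [l []]; rewrite !ffunE; have [->|li] := eqVneq l i.
    by rewrite ji aE /= => _ ->; left; case: (e i).
  have [->|lj] := eqVneq l j; first by rewrite bE => _ ->; right; case: (e j).
  by rewrite eqxx.
case=> ->; [exists i|exists j]; rewrite !ffunE ?eqxx ?ji ?(eq_sym j) ?ji ?aE ?bE.
  by case: (e i).
by case: (e j).
Qed.

Lemma wall_complex_npc : nonpositively_curved wall_complex.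
Proof.
move=> v E fE pairs.
have [s us sE] : exists2 s : seq {classic V}, uniq s & E = [set` s].
  have [s sE] := (finite_seqP (E : set {classic V})).1 fE.
  by exists (undup s); rewrite ?undup_uniq // sE; apply/seteqP; split=> x /=; rewrite mem_undup.
pose n := size s; pose e (i : 'I_n) : V := tnth (in_tuple s) i.
have einj : injective e := elimT (tuple_uniqP (in_tuple s)) us.
have Ee i : E (e i) by rewrite sE /=; exact: mem_tnth.
have eE x : E x -> exists i, x = e i.
  by rewrite sE /= => /(tnthP (in_tuple s)).
have [h hE] : {h & forall i, sep v (e i) = [set h i]}.
  apply: (choice (P := fun i k => sep v (e i) = [set k])) => i; apply/wall_adjacent.
  have [c _ [_ cE]] := pairs _ _ (Ee i) (Ee i).
  have : [set e i; e i] (e i) by left.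
  by rewrite cE => -[].
have hinj : injective h by move=> i j ij; apply: einj; apply: (@sep_inj v); rewrite !hE ij.
have hW i : [/\ W (h i), ~ h i v & h i (e i)].
  by have : sep v (e i) (h i) by rewrite hE.
(* The corner of the future cube for each subset: up to two halfspaces are covered by [v], [E] and
   [link_corner]. For three or more, take the median of the corners lacking [a], [b] and [c]
   respectively, as an index is missing from at most one of these. *)
have real (S : {set 'I_n}) : exists x, sep v x = [set k | exists2 i, i \in S & k = h i].
  have [m mE] := ubnP #|S|; elim: m S mE => // m IH S.
  have [->|[a aS]] := set_0Vmem S.
    move=> _; exists v; rewrite sepxx; apply/esym/seteqP; split=> // k [i]; by rewrite inE.
  have [S1|[b]] := set_0Vmem (S :\ a).
    move=> _; exists (e a); rewrite hE -(finset.setD1K aS) S1 finset.setU0.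
    by apply/seteqP; split=> [k ->|k [i]]; [exists a; rewrite ?inE|rewrite inE => /eqP ->].
  rewrite !inE => /andP[ba bS].
  have [S2|[c]] := set_0Vmem (S :\ a :\ b).
    move=> _; have [|q qE] := link_corner _ (hE a) (hE b) (pairs _ _ (Ee a) (Ee b)).
      by move/einj => ab; move: ba; rewrite ab eqxx.
    exists q; rewrite qE; apply/seteqP; split=> [k [] ->|k [i iS ->]].
    - by exists a.
    - by exists b.
    have : i \notin S :\ a :\ b by rewrite S2 inE.
    by rewrite !inE iS andbT negb_and !negbK => /orP[/eqP ->|/eqP ->]; [right|left].
  rewrite !inE => /and3P[cb ca cS] Sm.
  have sub x : x \in S -> exists y, sep v y = [set k | exists2 i, i \in S :\ x & k = h i].
    by move=> xS; apply: IH; move: Sm; rewrite (cardsD1 x S) xS.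
  have [ya yaE] := sub a aS; have [yb ybE] := sub b bS; have [yc ycE] := sub c cS.
  exists (med mw ya yb yc); apply/seteqP; split=> [k [Wk kv /(med_iff mw _ _ _ Wk) ky]|_ [i iS ->]].
    have : sep v ya k \/ sep v yb k by case: ky => [[]|[[]|[]]]; [left|right|left].
    by rewrite yaE ybE => -[[i + ->]|[i + ->]]; rewrite inE => /andP[_ iS]; exists i.
  have [Wh hv _] := hW i; split=> //.
  have at_ x y : sep v y = [set k | exists2 j, j \in S :\ x & k = h j] -> i != x -> h i y.
    move=> yE ix; have : sep v y (h i) by rewrite yE; exists i => //; rewrite !inE ix.
    by case.
  apply/(med_iff mw _ _ _ Wh).
  have [ia|ia] := eqVneq i a.
    right; left; rewrite ia in at_ *.
    by split; [apply: (at_ b) => //|apply: (at_ c) => //]; rewrite eq_sym.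
  have [ib|ib] := eqVneq i b; last by left; split; [exact: at_ ia|exact: at_ ib].
  right; right; rewrite ib in at_ ia *.
  by split; [exact: at_ ia|apply: (at_ c) => //; rewrite eq_sym].
have [f fE'] : {f : {ffun 'I_n -> bool} -> V &
    forall e, sep v (f e) = [set k | exists2 i, e i & k = h i]}.
  apply: (choice (P := fun (e : {ffun 'I_n -> bool}) x =>
    sep v x = [set k | exists2 i, e i & k = h i])) => e'.
  have [x xE] := real (finset.finset (fun i => e' i)); exists x; rewrite xE.
  by apply/seteqP; split=> k [i + ->]; rewrite ?inE => ei; exists i; rewrite ?inE.
have sp : spans h f by apply: (spans_corner (v := v)) => // i; case: (hW i).
exists (range f); first by exists 'I_n, h, f.
have fv : v = f [ffun=> false].
  apply: (sep_eq0 mw); rewrite fE'; apply/seteqP; split=> // k [i]; by rewrite ffunE.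
split; first by rewrite fv; eexists.
apply/seteqP; split=> x.
  move=> /eE[i ->]; split; last by apply/wall_adjacent; exists (h i).
  exists [ffun j => j == i] => //; apply: (@sep_inj v); rewrite fE' hE.
  apply/seteqP; split=> [k [j]|k ->]; first by rewrite ffunE => /eqP -> ->.
  by exists i; rewrite ?ffunE.
move=> [[e' _ <-] /wall_adjacent[k kE]].
have : sep v (f e') k by rewrite kE.
rewrite fE' => -[i _ ki]; suff -> : f e' = e i by exact: Ee.
by apply: (@sep_inj v); rewrite kE hE ki.
Qed.

Lemma wall_complex_CAT0 : (exists v : V, True) -> CAT0 wall_complex.
Proof.
by move=> v0; split; [exact: wall_complex_simply_connected|exact: wall_complex_npc].
Qed.

Lemma wall_cube_automorphism (f : V -> V) c : wall_automorphism W f ->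
  wall_cube c -> wall_cube (f @` c).
Proof.
move=> af [I [h [x [[Wh hx const] xc]]]]; have [[g fK gK] Wf] := af.
have gE i : f @^-1` (g @^-1` h i) = h i.
  by apply/seteqP; split=> z; rewrite /preimage /= fK.
exists I, (fun i => g @^-1` h i), (f \o x); split; last by rewrite -xc image_comp.
split=> [i|e i|k Wk av e e'].
- by apply/Wf; rewrite gE.
- by rewrite /preimage /= fK.
- apply: (const (f @^-1` k)); first exact: (Wf k).1.
  move=> i; have [a1 a2] := av i; split=> E; [apply: a1|apply: a2];
    apply: (preimage_inj af); rewrite E.
    by rewrite gE.
  by rewrite -preimage_setC gE.
Qed.

Lemma wall_automorphism_inv (f g : V -> V) : cancel f g -> cancel g f ->
  wall_automorphism W f -> wall_automorphism W g.
Proof.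
move=> fK gK [_ Wf]; split; first by exists f.
move=> h; rewrite (Wf (g @^-1` h)).
suff -> : f @^-1` (g @^-1` h) = h by [].
by apply/seteqP; split=> z; rewrite /preimage /= fK.
Qed.

Lemma cubical_automorphism_wall (f : V -> V) : wall_automorphism W f ->
  @cubical_automorphism wall_complex f.
Proof.
move=> af; have [fb Wf] := af; have [g fK gK] := fb; split=> // c; split.
  exact: wall_cube_automorphism.
have ag := wall_automorphism_inv fK gK af.
move=> /(wall_cube_automorphism ag); rewrite image_comp (_ : g \o f = id) ?image_id //.
by apply/funext => x /=.
Qed.

Lemma finite_wall_cube c : wall_cube c -> finite_set c.
Proof.
by move=> [I [h [f [_ <-]]]]; apply: finite_image; exact: finite_finset.
Qed.

(** A cube at [r] is determined by the neighbours of [r] in it; [Phi] recovers its vertices as those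
    reached by crossing only the walls of these edges. *)
Lemma finite_cubes_at r : finite_set (neighbours W r) ->
  finite_set [set c | wall_cube c /\ c r].
Proof.
move=> fr.
pose Phi (E : set V) := [set y | sep r y `<=` \bigcup_(u in E) sep r u].
apply: (sub_finite_set _ (finite_image Phi (finite_powerset fr))).
move=> c [/wall_cube_ord[n [h [f [sp fc]]]] cr].
have [e _ eE] : range f r by rewrite fc.
exists [set u | c u /\ nb (sep r u) = 1]; first by move=> u [].
apply/seteqP; split=> [y yP|y]; last first.
  rewrite -fc => -[ey _ <-] k; rewrite -{1}eE (spans_sep _ _ _ sp) => -[i [ei ->]].
  exists (f (flip i e)); last first.
    by rewrite -eE (ffun_flip_sep _ _ sp) /=; move: ei; case: (e i); case: (ey i).
  split; first by exists (flip i e).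
  by rewrite -eE (ffun_flip_sep _ _ sp) nb_set1.
suff -> : y = f [ffun i => `[< h i y >]] by rewrite -fc; eexists.
apply: (spans_point (e := e) sp) => k Wk av; rewrite eE => kr.
apply: contrapT => ky; have /yP [u [cu _]] : sep r y (~` k).
  by split=> //; exact: wallC.
case=> _ _; apply; move: kr; have [_ _ const] := sp.
by move: cu; rewrite -fc => -[eu _ <-]; rewrite -eE; exact: const.
Qed.

(** Cubes have finitely many vertices, so finite transporters between vertices give properness. For
    cocompactness, the compact set consists of the cubes with a corner in [R]. *)
Theorem cocompactly_cubulated_walls (G : groupType) (a : G -> V -> V) (R : set V) :
  (exists v : V, True) ->
  (forall x, a 1%g x = x) -> (forall g h x, a (g * h)%g x = a g (a h x)) ->
  (forall g, wall_automorphism W (a g)) ->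
  (forall x y, finite_set [set g | a g x = y]) ->
  finite_set R -> (forall x, exists g, exists2 r, R r & x = a g r) ->
  (forall r, R r -> finite_set (neighbours W r)) ->
  cocompactly_cubulated G.
Proof.
move=> v0 a1 aM aW afin fR RP Rn; exists wall_complex; split; first exact: wall_complex_CAT0.
exists a; split.
- by split=> // g; exact: cubical_automorphism_wall.
- move=> K fK Kc; pose P := \bigcup_(c in K) c.
  have fP : finite_set P.
    by apply: bigcup_finite => // c /Kc; exact: finite_wall_cube.
  apply: (@sub_finite_set _ _ (\bigcup_(x in P) \bigcup_(y in P) [set g | a g x = y])).
    move=> g [c [d [Kc' Kd [_ [[x cx <-] dy]]]]].
    exists x; first by exists c.
    by exists (a g x) => //; exists d.
  by apply: bigcup_finite => // x _; apply: bigcup_finite => // y _; exact: afin.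
- exists (\bigcup_(r in R) [set c | wall_cube c /\ c r]); split.
  + by apply: bigcup_finite => // r /Rn; exact: finite_cubes_at.
  + by move=> c [r _ []].
  move=> c cubc; have [I [h [f [_ fc]]]] := cubc.
  have cf : c (f [ffun=> false]) by rewrite -fc; eexists.
  have [g [r Rr E]] := RP (f [ffun=> false]).
  exists g, (a (g^-1)%g @` c).
    exists r => //; split; first exact: wall_cube_automorphism.
    by exists (f [ffun=> false]) => //; rewrite E -aM mulVg a1.
  move=> x cx; exists (a (g^-1)%g x); first by exists x.
  by rewrite -aM mulgV a1.
Qed.

End WallComplex.

(** * Centralisers *)

Lemma finite_bounded T (A : set T) (F : T -> nat) : finite_set A ->
  exists n, forall x, A x -> F x <= n.
Proof.
move=> fA; have [s sE] := (finite_seqP (A : set {classic T})).1 fA.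
exists (\max_(x <- s) F x) => x; rewrite sE /= => xs.
exact: (@leq_bigmax_seq {classic T}).
Qed.

Lemma finite_representatives T U (f : T -> U) (Y : set T) : finite_set (f @` Y) ->
  exists Z, [/\ finite_set Z, Z `<=` Y & forall x, Y x -> exists2 z, Z z & f z = f x].
Proof.
move=> fY; have [[y0 Yy0]|Y0] := pselect (Y !=set0); last first.
  exists set0; split=> // x Yx; by case: Y0; exists x.
have [g gP] : {g : U -> T & forall u, (f @` Y) u -> Y (g u) /\ f (g u) = u}.
  apply: (choice (P := fun u y => (f @` Y) u -> Y y /\ f y = u)) => u.
  have [[y Yy <-]|nu] := pselect ((f @` Y) u); first by exists y.
  by exists y0.
exists (g @` (f @` Y)); split; first exact: finite_image.
  by move=> _ [u /gP[gu _] <-].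
move=> x Yx; have fx : (f @` Y) (f x) by exists x.
by exists (g (f x)); [exists (f x)|case: (gP _ fx)].
Qed.

(** * Median subalgebras *)

Section Subalgebra.
Variables (V : Type) (W : set (set V)).
Hypothesis mw : median_walls W.
Variable M : set V.
Hypothesis M_med : forall x y z, M x -> M y -> M z -> M (med mw x y z).

(** Halfspaces with equal traces are identified; empty and full traces are kept, but they separate
    nothing. *)
Definition trace_walls : set (set {x | M x}) :=
  [set h | exists2 k, W k & h = sval @^-1` k].

Lemma sval_inj : injective (sval : {x | M x} -> V).
Proof.
by move=> [x Mx] [y My] /= xy; subst y; congr exist; exact: Prop_irrelevance.
Qed.

Lemma sep_trace (x y : {x | M x}) :
  sep trace_walls x y = preimage sval @` sep W (sval x) (sval y).
Proof.
apply/seteqP; split=> [_ [[k Wk ->] kx ky]|_ [k [Wk kx ky] <-]]; first by exists k.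
by split=> //; exists k.
Qed.

Lemma median_walls_trace : median_walls trace_walls.
Proof.
split.
- by move=> _ [k Wk ->]; exists (~` k) => //; exact: (wallC mw).
- by move=> x y; rewrite sep_trace; apply: finite_image; exact: (finite_sep mw).
- move=> x y xy; apply: sval_inj; apply: (sep_eq0 mw).
  apply/seteqP; split=> // k xyk.
  have : sep trace_walls x y (sval @^-1` k) by rewrite sep_trace; exists k.
  by rewrite xy.
- move=> x y z; exists (exist _ _ (M_med (svalP x) (svalP y) (svalP z))).
  by move=> _ [k Wk ->] /=; rewrite /preimage /= (med_iff mw _ _ _ Wk); tauto.
Qed.

(** The median is in [M] and between [x] and [y], so its side of the single trace [k] decides which
    of them it is. *)
Lemma trace_neighbours_gap (x y : {x | M x}) : nb (sep trace_walls x y) = 1 ->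
  forall w, M w -> med mw (sval x) (sval y) w = sval x \/ med mw (sval x) (sval y) w = sval y.
Proof.
move=> /(nb_eq1 (finite_sep median_walls_trace x y))[k xyk] w Mw.
pose m : {x | M x} := exist _ _ (M_med (svalP x) (svalP y) Mw).
have mE l : W l -> l (sval m) <-> (l (sval x) /\ l (sval y)) \/ (l (sval y) /\ l w) \/ (l (sval x) /\ l w).
  by move=> Wl; exact: med_iff.
have xm : sep trace_walls x m `<=` [set k].
  rewrite -xyk => _ [[l Wl ->]]; rewrite /preimage /= => lx /(mE _ Wl) lm.
  by split; [exists l|exact: lx|rewrite /preimage /=; tauto].
have my : sep trace_walls m y `<=` [set k].
  rewrite -xyk => _ [[l Wl ->]]; rewrite /preimage /= => lm ly.
  by split; [exists l|move=> /= lx; apply: lm; apply/(mE _ Wl); tauto|].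
have [km|km] := pselect (k m); [right|left].
  apply: (congr1 sval (_ : m = y)); apply: (sep_eq0 median_walls_trace).
  apply/seteqP; split=> // l ml; have lk := my _ ml.
  by case: ml => _ + _; rewrite lk.
apply: (congr1 sval (_ : m = x)); apply/esym/(sep_eq0 median_walls_trace).
apply/seteqP; split=> // l xl; have lk := xm _ xl.
by case: xl => _ _; rewrite lk.
Qed.

End Subalgebra.

(** * Geometric actions and centralisers *)

Section GeometricAction.
Variables (V : Type) (W : set (set V)).
Hypothesis mw : median_walls W.
Local Notation sep := (sep W).
Local Notation med := (med mw).
Local Notation finite_sep := (finite_sep mw).
Local Notation wallC := (wallC mw).

Variables (G : groupType) (a : G -> V -> V) (R : set V) (x0 : V).
Hypothesis a1 : forall x, a 1%g x = x.
Hypothesis aM : forall g h x, a (g * h)%g x = a g (a h x).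
Hypothesis aW : forall g, wall_automorphism W (a g).
Hypothesis afin : forall x y, finite_set [set g | a g x = y].
Hypothesis finR : finite_set R.
Hypothesis orbitR : forall x, exists g, exists2 r, R r & x = a g r.
Hypothesis finite_neighbours : forall x, finite_set (neighbours W x).

Let aK g : cancel (a g) (a (g^-1)%g).
Proof. by move=> x; rewrite -aM mulVg a1. Qed.

Let aKV g : cancel (a (g^-1)%g) (a g).
Proof. by move=> x; rewrite -aM mulgV a1. Qed.

Let nb_sep_act g x y : nb (sep (a g x) (a g y)) = nb (sep x y).
Proof. exact: nb_sep_automorphism. Qed.

Lemma bounded_degree : exists D, forall x, nb (neighbours W x) <= D.
Proof.
have [D DP] := finite_bounded (fun r => nb (neighbours W r)) finR.
exists D => x; have [g [r /DP rD ->]] := orbitR x.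
apply: leq_trans rD; apply: (nb_le_inj (f := a (g^-1)%g)) => //.
- by move=> y; rewrite /neighbours /= -{1}(aKV g y) nb_sep_act.
- by move=> y z _ _ /(congr1 (a g)); rewrite !aKV.
Qed.

Lemma closer_neighbour x y : x <> y -> exists z,
  [/\ nb (sep x z) = 1, sep z y `<=` sep x y & nb (sep x y) = (nb (sep z y)).+1].
Proof.
move=> xy; have [h xyh] : sep x y !=set0.
  by apply: contrapT => /set0P/negP/negPn/eqP/(sep_eq0 mw).
have [k xyk [_ kmax]] := exists_maximal (finite_sep x y) xyh.
have [z xz] := sep_maximal_adjacent mw xyk kmax.
have zy := sep_shift mw xyk xz.
exists z; rewrite xz nb_set1 zy; split=> [//|l []//|].
have fin : finite_set (sep x y `\ k) by apply: sub_finite_set (finite_sep x y) => l [].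
have nk : ~ (sep x y `\ k) k by move=> [_]; apply.
by rewrite -(nb_setU1 fin nk) setD1K.
Qed.

Lemma finite_ball x n : finite_set [set y | nb (sep x y) <= n].
Proof.
elim: n x => [|n IH] x.
  apply: (sub_finite_set _ (finite_set1 x)) => y /=; rewrite leqn0 => /eqP.
  by move/(nb_sep_eq0 mw).
apply: (@sub_finite_set _ _ ([set x] `|`
    \bigcup_(z in neighbours W x) [set y | nb (sep z y) <= n])); last first.
  rewrite finite_setU; split; first exact: finite_set1.
  by apply: bigcup_finite.
move=> y /= xy; have [->|ne] := pselect (y = x); [by left|right].
have [|z [xz _ E]] := @closer_neighbour x y; first by move=> e; apply: ne.
by exists z => //=; rewrite -ltnS -E.
Qed.

Lemma finite_almost_fixing x n : finite_set [set g | nb (sep x (a g x)) <= n].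
Proof.
apply: (@sub_finite_set _ _ (\bigcup_(y in [set y | nb (sep x y) <= n]) [set g | a g x = y])).
  by move=> g gx; exists (a g x).
by apply: bigcup_finite => [|y _]; [exact: finite_ball|exact: afin].
Qed.

(** The Milnor-Svarc argument: each vertex of a geodesic from [a g x0] to [x0] is within [L] of the
    orbit of [x0], so orbit points chosen near consecutive vertices are at distance at most
    [L + 1 + L]. *)
Lemma finitely_generated_action : exists2 S : set G, finite_set S &
  forall K : set G, subgroup K -> S `<=` K -> forall g, K g.
Proof.
have [L LP] := finite_bounded (fun r => nb (sep r x0)) finR.
exists [set g | nb (sep x0 (a g x0)) <= L + 1 + L]; first exact: finite_almost_fixing.
move=> K [_ KM _] SK g.
suff H n x k : nb (sep x x0) = n -> nb (sep x (a k x0)) <= L -> K k.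
  by apply: (H _ (a g x0) g (erefl _)); rewrite sepxx nb0.
elim: n x k => [|n IH] x k dn xk.
  by apply: SK => /=; move: xk; rewrite (nb_sep_eq0 mw dn); lia.
have [|y [xy _ E]] := @closer_neighbour x x0.
  by move=> xx0; move: dn; rewrite xx0 sepxx nb0.
have [h [r Rr yE]] := orbitR y.
have yh : nb (sep y (a h x0)) <= L by rewrite yE nb_sep_act; exact: LP.
have Kh : K h by apply: (IH y) => //; move: E; rewrite dn => -[].
have -> : k = (h * (h^-1 * k))%g by rewrite mulgA mulgV mul1g.
apply: KM => //; apply: SK => /=.
rewrite -(nb_sep_act h) -aM mulgA mulgV mul1g.
have := nb_sep_triangle mw y (a h x0) (a k x0); rewrite (nb_sepC mw (a h x0) y).
have := nb_sep_triangle mw x y (a k x0); rewrite (nb_sepC mw y x) xy; lia.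
Qed.

Section Centraliser.
Variables (S : set G) (H : groupType) (phi : H -> G).
Hypothesis finS : finite_set S.
Hypothesis phi1 : phi 1%g = 1%g.
Hypothesis phiM : forall x y, phi (x * y)%g = (phi x * phi y)%g.
Hypothesis phi_inj : injective phi.
Hypothesis phi_comm : forall z s, S s -> commute (phi z) s.
Hypothesis phi_range : forall g, (forall s, S s -> commute g s) -> exists z, phi z = g.

Definition displaced C := [set x | forall s, S s -> nb (sep x (a s x)) <= C].

Lemma displaced_cofinite C : exists T, [/\ finite_set T, T `<=` displaced C &
  forall x, displaced C x -> exists z, exists2 t, T t & x = a (phi z) t].
Proof.
have [gr grP] : {gr : V -> G * V & forall x, R (gr x).2 /\ x = a (gr x).1 (gr x).2}.
  apply: (choice (P := fun x (q : G * V) => R q.2 /\ x = a q.1 q.2)) => x.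
  by have [g [r Rr ->]] := orbitR x; exists (g, r).
(* The graph of conjugation on [S], as a set: it is a subset of the finite set [S] x [F], so it
   takes finitely many values. *)
pose conj x := [set q : G * G | S q.1 /\ q.2 = ((gr x).1^-1 * q.1 * (gr x).1)%g].
pose F := \bigcup_(r in R) [set k | nb (sep r (a k r)) <= C].
have fF : finite_set F by apply: bigcup_finite => // r _; exact: finite_almost_fixing.
have [|T [fT TY TP]] := @finite_representatives _ _ (fun x => ((gr x).2, conj x)) (displaced C).
  apply: (@sub_finite_set _ _ (R `*` [set B | B `<=` S `*` F])); last first.
    by apply: finite_setX => //; apply: finite_powerset; exact: finite_setX.
  move=> _ [x Cx <-]; split=> /=; first by case: (grP x).
  move=> [s k] [/= Ss ->]; split=> //=; have [Rr xE] := grP x.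
  exists (gr x).2 => //=; rewrite -(nb_sep_act (gr x).1) -!aM !mulgA mulgV mul1g aM -xE.
  exact: Cx.
exists T; split=> // x /[dup] Cx /TP[t Tt [rE cE]].
(* Two elements conjugating [S] in the same way differ by an element of the centraliser. *)
have [z zE] : exists z, phi z = ((gr x).1 * (gr t).1^-1)%g.
  apply: phi_range => s Ss.
  have : conj x (s, ((gr x).1^-1 * s * (gr x).1)%g) by [].
  rewrite -cE => -[/= _ E]; rewrite /commute.
  apply: (mulgI (gr x).1^-1%g); apply: (mulIg (gr t).1%g).
  by rewrite !mulgA mulVg mul1g mulgVK E.
exists z, t => //; have [_ xE] := grP x; have [_ tE] := grP t.
by rewrite zE aM (canLR (aK _) tE) rE.
Qed.

Lemma displaced_act C z x : displaced C x -> displaced C (a (phi z) x).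
Proof.
move=> Cx s Ss; rewrite -aM -(phi_comm z Ss) aM nb_sep_act; exact: Cx.
Qed.

(* This is the median subalgebra generated by [A]: in a discrete median algebra, the
   halfspace criterion for membership replaces iterating the median. *)
Definition median_hull (A : set V) := [set x | forall h k, W h -> W k -> h x -> k x ->
  exists2 y, A y & h y /\ k y].

Lemma sub_median_hull A : A `<=` median_hull A.
Proof. by move=> x Ax h k _ _ hx kx; exists x. Qed.

Lemma median_hull_med A x y z : median_hull A x -> median_hull A y -> median_hull A z ->
  median_hull A (med x y z).
Proof.
move=> Ax Ay Az h k Wh Wk /(med_iff mw _ _ _ Wh) hm /(med_iff mw _ _ _ Wk) km.
have [[hx kx]|[[hy ky]|[hz kz]]] : (h x /\ k x) \/ (h y /\ k y) \/ (h z /\ k z) by tauto.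
- exact: Ax.
- exact: Ay.
- exact: Az.
Qed.

Lemma median_hull_displaced_act C z x :
  median_hull (displaced C) x -> median_hull (displaced C) (a (phi z) x).
Proof.
have [_ Wa] := aW (phi z).
move=> Mx h k /(Wa h).1 Wh /(Wa k).1 Wk hx kx.
have [y Cy [hy ky]] := Mx _ _ Wh Wk hx kx.
by exists (a (phi z) y) => //; exact: displaced_act.
Qed.

(** All halfspaces between [x] and [a s x] have level less than [C], and each level has at most [D]
    of them. *)
Lemma median_hull_displaced D C : (forall x, nb (neighbours W x) <= D) ->
  median_hull (displaced C) `<=` displaced (C * D).
Proof.
move=> deg x Mx s Ss.
apply: leq_trans (nb_levels mw finite_neighbours deg x (a s x) 0 C).
apply: nb_sub.
  by apply: sub_finite_set (finite_sep x (a s x)) => h [].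
move=> h xh; split=> // lev.
have [top [[Wt tx _] _ topP]] := level_chain mw xh lev.
have [Wh _ hsx] := xh; have [_ Wa] := aW s.
(* [x] lies outside [top] and in the preimage of [h] under [s]. The hull provides a point of
   [displaced C] with both properties, which [s] would move across [C + 1] halfspaces. *)
have [y Cy [ty hy]] := Mx _ _ (wallC Wt) ((Wa h).1 Wh) tx hsx.
have := topP y (a s y) ty hy; rewrite ltnNge => /negP; apply.
apply: leq_trans (Cy s Ss); apply: nb_sub; [exact: finite_sep|by move=> w []].
Qed.

(** Coarse connectivity: [B.1] bounds the displacement defining the hull, and [B.2] bounds the jumps
    within it. *)
Definition linked B (x y : V) := clos_refl_sym_trans _
  (fun x y => [/\ median_hull (displaced B.1) x, median_hull (displaced B.1) y &
                  nb (sep x y) <= B.2]) x y.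

Lemma displaced_linked D C L u v : (forall x, nb (neighbours W x) <= D) -> D <= L ->
  displaced C u -> displaced C v -> linked (2 * C + 2 * C * D, L) u v.
Proof.
move=> deg DL Cu Cv.
have [p pP] : {p & forall n, normal_vertex W u v n (p n)}.
  apply: choice => n; exact: normal_vertex_exists.
(* [s] carries the normal path from [u] to [v] to the one between their images, whose endpoints are
   within [C] of [u] and [v]. *)
have Cp n : displaced (2 * C + 2 * C * D) (p n).
  move=> s Ss; apply: (normal_vertex_fellow mw finite_neighbours deg (Cu s Ss) (Cv s Ss) (pP n)).
  exact: normal_vertex_automorphism.
rewrite -(normal_vertex0 mw (pP 0)) -(normal_vertex_last mw (pP (nb (sep u v)))).
elim: (nb _) => [|n IH]; first exact: rst_refl.
apply: rst_trans IH _; apply: rst_step; split; try exact: sub_median_hull.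
exact: leq_trans (nb_normal_vertexS mw finite_neighbours deg (pP n) (pP n.+1)) DL.
Qed.

(** The map w -> [med x y w] is 1-Lipschitz with values [x] and [y] on the hull. If these were more
    than [B.2] apart, it would be constant along the chain linking [x] to [y], both of which it
    fixes. *)
Lemma nb_sep_gap B x y : linked B x y -> median_hull (displaced B.1) x -> 
  median_hull (displaced B.1) y ->
  (forall w, median_hull (displaced B.1) w -> med x y w = x \/ med x y w = y) ->
  nb (sep x y) <= B.2.
Proof.
move=> xy Mx My gap; have [//|lt] := leqP (nb (sep x y)) B.2; exfalso.
have medx w : W `<=` [set h | h (med x y w) <-> (h x /\ h y) \/ (h y /\ h w) \/ (h x /\ h w)].
  by move=> h Wh; exact: med_iff.
have lip w w' : sep (med x y w) (med x y w') `<=` sep w w'.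
  move=> h [Wh /(medx w h Wh) + /(medx w' h Wh)] => hw hw'; split=> //; tauto.
have side w w' : linked B w w' -> med x y w = x <-> med x y w' = x.
  elim=> [{}w {}w' [Mw Mw' ww']|//|{}w {}w' _ ->//|w1 w2 w3 _ -> _ ->//].
  have le : nb (sep (med x y w) (med x y w')) <= B.2.
    apply: leq_trans ww'; apply: nb_sub; [exact: finite_sep|exact: lip].
  have [e|e] := gap _ Mw; have [e'|e'] := gap _ Mw'; rewrite ?e ?e' //.
    by move: le lt; rewrite e e'; lia.
  by move: le lt; rewrite e e' nb_sepC //; lia.
have xx : med x y x = x by apply: (eq_walls mw) => h Wh hx; apply/(medx x h Wh); tauto.
have yy : med x y y = y by apply: (eq_walls mw) => h Wh hy; apply/(medx y h Wh); tauto.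
have := (side _ _ xy).1 xx; rewrite yy => yx.
by move: lt; rewrite yx sepxx nb0.
Qed.

Theorem cocompactly_cubulated_centraliser : cocompactly_cubulated H.
Proof.
have [D deg] := bounded_degree.
have [C0 C0P] := finite_bounded (fun s => nb (sep x0 (a s x0))) finS.
(* The displacement allowed on normal paths between points of the orbit of [x0], which are displaced
   by at most [C0]. *)
pose C1 := 2 * C0 + 2 * C0 * D.
pose M := median_hull (displaced C1).
have C01 C x : C <= C1 -> displaced C x -> displaced C1 x.
  by move=> le Cx s Ss; apply: leq_trans le; exact: Cx.
have Cx0 z : displaced C0 (a (phi z) x0) by apply: displaced_act => s; exact: C0P.
have Mx0 z : M (a (phi z) x0).
  by apply: sub_median_hull; apply: (C01 C0) => //; rewrite /C1; lia.
(* [M] is contained in [displaced (C1 * D)], so [T] represents its orbits. *)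
have [T [finT _ TP]] := displaced_cofinite (C1 * D).
have [L LP] := finite_bounded (fun t => nb (sep t x0)) finT.
(* A jump of at most [L] leads from a point of [M] to the orbit of [x0], and steps of at most [D]
   along normal paths join the points of this orbit. *)
pose B := (C1, D + L).
have Mlink x : M x -> exists z, linked B x (a (phi z) x0).
  move=> Mx; have [z [t Tt xE]] := TP x (median_hull_displaced deg Mx).
  exists z; apply: rst_step; split; [exact: Mx|exact: Mx0|rewrite /= xE nb_sep_act].
  by apply: leq_trans (LP t Tt) _; rewrite leq_addl.
have link x y : M x -> M y -> linked B x y.
  move=> /Mlink[z xz] /Mlink[z' yz']; apply: rst_trans xz _; apply: rst_trans (rst_sym _ _ _ _ yz').
  by apply: displaced_linked; rewrite ?leq_addr.
have Mmed x y z : M x -> M y -> M z -> M (med x y z) by exact: median_hull_med.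
have Mact z x : M x -> M (a (phi z) x) by exact: median_hull_displaced_act.
pose act z (x : {x | M x}) : {x | M x} := exist _ _ (Mact z _ (svalP x)).
have act1 x : act 1%g x = x by apply: sval_inj; rewrite /= phi1 a1.
have actM z z' x : act (z * z')%g x = act z (act z' x).
  by apply: sval_inj; rewrite /= phiM aM.
have actW z h : @trace_walls V W M h -> @trace_walls V W M (act z @^-1` h).
  move=> [k Wk ->]; exists (a (phi z) @^-1` k) => //.
  by have [_ Wa] := aW (phi z); exact: (Wa k).1.
have cc := @cocompactly_cubulated_walls _ _ (median_walls_trace Mmed) H act
  [set x : {x | M x} | T (sval x)].
apply: cc => //.
- by exists (exist _ _ (Mx0 1%g)).
- move=> z; have K z1 z2 : (z1 * z2)%g = 1%g -> cancel (act z2) (act z1).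
    by move=> z12 x; rewrite -actM z12 act1.
  split; first by exists (act (z^-1)%g); apply: K; rewrite ?mulVg ?mulgV.
  move=> h; split; first exact: actW.
  move=> /(actW (z^-1)%g); congr trace_walls.
  by apply/seteqP; split=> x; rewrite /preimage /= K ?mulgV.
- move=> x y; apply: (@sub_finite_set _ _ (phi @^-1` [set g | a g (sval x) = sval y])).
    by move=> z /= <-.
  by apply: finite_preimage => // z z' _ _; exact: phi_inj.
- apply: (@finite_preimage _ _ T sval) => // x y _ _; exact: sval_inj.
- move=> x; have Mx := svalP x.
  have [z [t Tt xE]] := TP _ (median_hull_displaced deg Mx).
  have Mt : M t by have := Mact (z^-1)%g _ Mx; rewrite xE -aM -phiM mulVg phi1 a1.
  by exists z; exists (exist _ t Mt) => //; apply: sval_inj.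
- move=> x _; apply: (@sub_finite_set _ _ (sval @^-1` [set y | nb (sep (sval x) y) <= D + L])).
    move=> y; rewrite /neighbours /= => xy1.
    apply: (nb_sep_gap (B := B)); [exact/link/svalP/svalP|exact: svalP|exact: svalP|].
    exact: trace_neighbours_gap xy1.
  apply: finite_preimage; last exact: finite_ball.
  by move=> y y' _ _; exact: sval_inj.
Qed.

End Centraliser.
End GeometricAction.

(** * Proof of the theorem *)

Lemma smallest_subgroup (G : groupType) (S : set G) : subgroup (smallest (@subgroup G) S).
Proof.
split=> [K [[K1 _ _] _]//|x y Sx Sy K KS|x Sx K KS]; have [[_ KM KV] _] := KS.
  by apply: KM; [exact: Sx|exact: Sy].
by apply: KV; exact: Sx.
Qed.

Lemma finite_cube (X : cube_complex) (c : set X) : cube c -> finite_set c.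
Proof. by case/cubeP => n [f [_ <- _]]; apply: finite_image; exact: finite_finset. Qed.

Lemma geometric_action_walls (G : groupType) : cocompactly_cubulated G ->
  exists (V : Type) (W : set (set V)) (a : G -> V -> V) (R : set V),
  [/\ median_walls W, (exists x : V, True), finite_set R &
   [/\ forall x, a 1%g x = x, forall g h x, a (g * h)%g x = a g (a h x) &
       forall g, wall_automorphism W (a g)] /\
   [/\ forall x y, finite_set [set g | a g x = y],
       forall x, exists g, exists2 r, R r & x = a g r &
       forall x, finite_set (neighbours W x)]].
Proof.
move=> [X [cat0 [a [[a1 aM aC] prop [K [finK Kc cocpt]]]]]].
exists X, (halfspaces cat0), a, (\bigcup_(c in K) c).
have finR : finite_set (\bigcup_(c in K) c).
  by apply: bigcup_finite => // c /Kc; exact: finite_cube.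
split=> //; first exact: median_walls_halfspaces.
  by case: cat0 => -[[]].
split; first by split=> // g; exact: automorphism_walls.
split.
- move=> x y; have fK : finite_set [set [set x]; [set y]].
    by rewrite finite_setU; split; exact: finite_set1.
  have Kxy : [set [set x]; [set y]] `<=` @cube X by move=> _ [] ->; exact: cube1.
  apply: (sub_finite_set _ (prop _ fK Kxy)) => g /= gx.
  exists [set x], [set y]; split; [by left|by right|].
  by exists y; split=> //; exists x.
- move=> x; have [g [k Kk xk]] := cocpt _ (cube1 x).
  have [r kr xE] := xk x erefl.
  by exists g, r; [exists k|].
- move=> x.
  (* An edge at [x] lies in a translate of a cube of [K], and this translate meets [{x}]; properness
     for [K'] leaves finitely many translates. *)
  pose K' := K `|` [set [set x]].
  have fK' : finite_set K' by rewrite finite_setU; split=> //; exact: finite_set1.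
  have Kc' : K' `<=` @cube X by move=> _ [/Kc//|->]; exact: cube1.
  have fS := prop _ fK' Kc'.
  apply: (@sub_finite_set _ _ (\bigcup_(g in [set g | exists c d,
      [/\ K' c, K' d & (a g @` c) `&` d !=set0]]) \bigcup_(k in K) (a g @` k))); last first.
    by apply: bigcup_finite => // g _; apply: bigcup_finite => // k /Kc kc;
      apply: finite_image; exact: finite_cube.
  move=> y /(adjacent_nb_sep) /adjP[_ /cocpt [g [k Kk xyk]]].
  exists g; last by exists k => //; apply: xyk; right.
  exists k, [set x]; split; [by left|by right|].
  by exists x; split=> //; apply: xyk; left.
Qed.

Lemma cocompactly_cubulated_fg (G : groupType) : cocompactly_cubulated G ->
  exists2 S : set G, finite_set S & forall K : set G, subgroup K -> S `<=` K -> forall g, K g.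
Proof.
move=> /geometric_action_walls[V [W [a [R [mw [x0 _] fR [[a1 aM aW] [afin orb nf]]]]]]].
exact: (finitely_generated_action mw x0 aM aW afin fR orb nf).
Qed.

Lemma cocompactly_cubulated_centraliser_group (G : groupType) (H : set G) :
  cocompactly_cubulated G -> finitely_generated H ->
  cocompactly_cubulated (centraliser_group H).
Proof.
move=> /geometric_action_walls[V [W [a [R [mw [x0 _] fR [[a1 aM aW] [afin orb nf]]]]]]].
move=> [S fS HS].
have SH s : S s -> H s by rewrite HS => Ss K [_]; apply.
apply: (cocompactly_cubulated_centraliser mw x0 a1 aM aW afin fR orb nf (S := S)
  (phi := @centraliser_val G H)) => //.
- by move=> x y; exact: val_inj.
- by move=> [z /= /asboolP zH] s /SH; exact: zH.
move=> g gS; have gH : g \in centraliser H.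
  apply/asboolP => h; rewrite HS => /(_ [set h | commute g h]); apply; split=> //.
  split=> [|x y gx gy|x gx] /=; first exact: commute1.
    exact: commuteM.
  exact: commuteV.
by exists (CentraliserGroup gH).
Qed.

(** The restricted action stays proper by injectivity of [psi], and the translates of [K] by the
    coset representatives in [T] form its compact set. *)
Lemma cocompactly_cubulated_finite_index (A B : groupType) (psi : A -> B) (T : set B) :
  psi 1%g = 1%g -> (forall x y, psi (x * y)%g = (psi x * psi y)%g) -> injective psi ->
  finite_set T -> (forall b, exists x, exists2 t, T t & b = (psi x * t)%g) ->
  cocompactly_cubulated B -> cocompactly_cubulated A.
Proof.
move=> psi1 psiM psi_inj finT cosets [X [cat0 [a [[a1 aM aC] prop [K [finK Kc cocpt]]]]]].
exists X; split=> //; exists (a \o psi); split.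
- split=> [x|g h x|g]; [by rewrite /= psi1|by rewrite /= psiM|exact: aC].
- move=> K' fK' Kc'; apply: (@sub_finite_set _ _ (psi @^-1` [set g : B | exists c d,
      [/\ K' c, K' d & (a g @` c) `&` d !=set0]])) => //.
  by apply: finite_preimage; [move=> x y _ _; exact: psi_inj|exact: prop].
- exists (\bigcup_(t in T) ((fun k => a t @` k) @` K)); split.
  + by apply: bigcup_finite => // t _; exact: finite_image.
  + move=> _ [t _ [k /Kc kc <-]]; have [_ at_] := aC t; exact: (at_ k).1.
  move=> c /cocpt[g [k Kk ck]]; have [x [t Tt gE]] := cosets g.
  exists x, (a t @` k); first by exists t => //; exists k.
  move=> y /ck[z kz <-]; exists (a t z); first by exists z.
  by rewrite gE aM.
Qed.

Theorem corollaryE (G : groupType) (cubG : cocompactly_cubulated G) :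
  (forall H : set G, subgroup H -> finitely_generated H ->
     cocompactly_cubulated (centraliser_group H))
  /\
  (forall (G1 G2 : groupType) (f : {multiplicative (G1 * G2)%type -> G}),
     bijective f -> finite_set (centre G2) ->
     cocompactly_cubulated G1).
Proof.
split=> [H _|G1 G2 f [f' fK f'K] finZ].
  exact: cocompactly_cubulated_centraliser_group.
have pairM (u u' : G1) (v v' : G2) : ((u, v) * (u', v') = (u * u', v * v'))%g by [].
have fM x y : f (x * y)%g = (f x * f y)%g by exact: gmulfM.
have f1 : f 1%g = 1%g.
  by apply: (mulgI (f 1%g)); rewrite -fM !mulg1.
have fV x : f (x^-1)%g = ((f x)^-1)%g.
  by apply: (mulgI (f x)); rewrite -fM !mulgV f1.
have finj := can_inj fK.
pose i2 (y : G2) : G := f (1%g, y).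
have i2M x y : i2 (x * y)%g = (i2 x * i2 y)%g.
  by rewrite /i2 -fM pairM mulg1.
have i21 : i2 1%g = 1%g by exact: f1.
have i2V x : i2 (x^-1)%g = ((i2 x)^-1)%g.
  by apply: (mulgI (i2 x)); rewrite -i2M !mulgV i21.
have f'M x y : f' (x * y)%g = (f' x * f' y)%g by apply: finj; rewrite fM !f'K.
have f'1 : f' 1%g = 1%g by apply: finj; rewrite f1 f'K.
have f'V x : f' (x^-1)%g = ((f' x)^-1)%g by apply: finj; rewrite fV !f'K.
have [S finS SP] := cocompactly_cubulated_fg cubG.
pose H : set G := range i2.
have fgH : finitely_generated H.
  (* [p] is the retraction of [G] onto the second factor, so it carries generators of [G] to
     generators of [H]. *)
  pose p g := i2 (f' g).2.
  exists (p @` S); first exact: finite_image.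
  have [s1 sM sV] := smallest_subgroup (p @` S).
  apply/seteqP; split=> [_ [y _ <-]|x]; last first.
    apply; split; last by move=> _ [s _ <-]; exists (f' s).2.
    split; first by exists 1%g.
      by move=> _ _ [u _ <-] [v _ <-]; exists (u * v)%g.
    by move=> _ [u _ <-]; exists (u^-1)%g.
  have -> : i2 y = p (f (1%g, y)) by rewrite /p fK.
  apply: (SP [set g | smallest (@subgroup G) (p @` S) (p g)]).
    split=> [|u v su sv|u su] /=.
    - by rewrite /p f'1 i21.
    - by rewrite /p f'M i2M; exact: sM.
    - by rewrite /p f'V i2V; exact: sV.
  by move=> s Ss /= K [_]; apply; exists s.
have cub := cocompactly_cubulated_centraliser_group cubG fgH.
have i1H (x : G1) : f (x, 1%g) \in centraliser H.
  by apply/asboolP => _ [y _ <-]; rewrite /commute /i2 -!fM !pairM !mulg1 !mul1g.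
pose psi x := CentraliserGroup (i1H x).
(* The copy of the finite centre of [G2] contains a representative of every coset of the first
   factor in the centraliser. *)
apply: (cocompactly_cubulated_finite_index (psi := psi)
  (T := [set z | exists2 c, centre G2 c & centraliser_val z = i2 c])) cub.
- by apply: val_inj => /=; exact: f1.
- by move=> x y; apply: val_inj; rewrite /= -fM pairM mulg1.
- by move=> x y /(congr1 (@centraliser_val G H)) /= /finj[].
- apply: (@sub_finite_set _ _ (@centraliser_val G H @^-1` (i2 @` centre G2))).
    by move=> z [c cc zE]; exists c.
  apply: finite_preimage; last exact: finite_image.
  by move=> x y _ _; exact: val_inj.
move=> z; case E : (f' (centraliser_val z)) => [x c].
have zE : centraliser_val z = f (x, c) by rewrite -E f'K.
have fxc : f (x, c) = (f (x, 1%g) * i2 c)%g.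
  by rewrite /i2 -fM pairM mulg1 mul1g.
have cc : centre G2 c.
  move=> y; have : commute (centraliser_val z) (i2 y).
    by case: (z) => u /= /asboolP; apply; exists y.
  by rewrite /commute zE /i2 -!fM => /finj; case.
have icH : i2 c \in centraliser H.
  apply/asboolP => _ [y _ <-]; rewrite /commute -!i2M; congr i2; exact: cc.
exists x, (CentraliserGroup icH); first by exists c.
by apply: val_inj; rewrite /= zE fxc.
Qed.
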